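(* Let $\mathcal{A}$ be the set of abelian extensions $K$ of $\mathbb{Q}$ whose conductor is a power $p^r$ ($r\ge 1$) of an odd prime $p$. There exist functions $\varepsilon:\mathcal{A}\to\mathbb{R}$ and $C:\mathcal{A}\to\mathbb{R}$ such that for every $K\in\mathcal{A}$: (i) $\varepsilon(K)\le 2$ and $C(K)\le \frac13$, and \[ M(K)\le C(K)^{n_K}\,\big(\sqrt{D_K}\big)^{\varepsilon(K)}; \] (ii) if $[K:\mathbb{Q}]>2$, then $\varepsilon(K)<2$; (iii) $\lim_{n_K\to\infty}\varepsilon(K)=1$ (limit over $\mathcal{A}$); (iv) $\lim_{p_K\to\infty} C(K)=\frac{1}{2\sqrt3}$, where the limit is taken over the subfamily $\{K\in\mathcal{A}: r_K\ge 2\}$, and also over each subfamily $\{K\in\mathcal{A}: r_K=1,\ [\mathbb{Q}(\zeta_{p_K}):K]=e_0\}$ for a fixed integer $e_0$.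
   Context: For a number field $K$ with ring of integers $\mathcal{O}_K$, let $\mathrm{N}$ denote the absolute value of the norm $K\to\mathbb{Q}$, and define the Euclidean minimum $M(K)=\sup_{x\in K}\inf_{c\in\mathcal{O}_K}\mathrm{N}(x-c)$. For $K\in\mathcal{A}$: $n_K=[K:\mathbb{Q}]$, $D_K$ is the absolute value of the discriminant of $K$, $p_K$ is the unique prime dividing the conductor, $r_K$ is the $p_K$-adic valuation of the conductor. For a subset $\mathcal{D}\subset\mathcal{A}$ and $\psi:\mathcal{D}\to\mathbb{R}$, $\lim_{n_K\to\infty}\psi(K)=\psi_0$ means: for every $\epsilon>0$ there is $N$ such that for all $K\in\mathcal{D}$ with $n_K>N$ one has $|\psi(K)-\psi_0|<\epsilon$; $\lim_{p_K\to\infty}\psi(K)=\psi_0$ is defined analogously with $p_K>N$. *)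

(* Defs.v *)
From mathcomp Require Import all_boot all_order all_fingroup all_algebra.
From mathcomp Require Import all_field.
From mathcomp Require Import all_classical all_reals ereal exp.

Set Implicit Arguments.
Unset Strict Implicit.
Unset Printing Implicit Defensive.

Import Order.TTheory GRing.Theory Num.Theory.

Local Open Scope classical_set_scope.
Local Open Scope ring_scope.

(* A number field is a [fieldExtType rat], i.e. a finite extension of Q. *)

Definition nf_degree (K : fieldExtType rat) : nat := \dim {:K}.

(* Matrix of y |-> y * x; its determinant and trace do not depend on the
   chosen basis. *)
Definition nf_mulmx (K : fieldExtType rat) (x : K) :=
  passmx.mxof (vbasis {:K}) (vbasis {:K}) (amulr x).

Definition nf_trace (K : fieldExtType rat) (x : K) : rat := \tr (nf_mulmx x).

Definition nf_absnorm (K : fieldExtType rat) (x : K) : rat :=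
  `|\det (nf_mulmx x)|.

Definition nf_integers (K : fieldExtType rat) : set K :=
  [set x : K | integralOver (intr : int -> K) x].
Arguments nf_integers : clear implicits.

(* The values are extended reals because the real-valued [sup] is 0 on an
   unbounded set. *)
Definition euclidean_minimum (R : realType) (K : fieldExtType rat) : \bar R :=
  ereal_sup
    (range (fun x : K =>
       ereal_inf [set (ratr (nf_absnorm (x - c)) : R)%:E | c in nf_integers K])).

Definition integral_basis (K : fieldExtType rat)
    (b : (nf_degree K).-tuple K) : Prop :=
  basis_of {:K} b /\ nf_integers K = [set x | inIntSpan b x].

Definition trace_disc (K : fieldExtType rat) (b : (nf_degree K).-tuple K) : rat :=
  \det (\matrix_(i, j) nf_trace (tnth b i * tnth b j)).

(* [xget] picks the common value of |det (Tr (b_i b_j))| over all integral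
   bases b; the default value 0 is never used, since integral bases exist. *)
Definition nf_absdisc (K : fieldExtType rat) : rat :=
  xget 0 [set d | exists2 b : (nf_degree K).-tuple K,
                    integral_basis b & d = `|trace_disc b| ].

Definition is_cyclotomic (m : nat) (L : fieldExtType rat) : Prop :=
  exists2 z : L, m.-primitive_root z & <<1; z>>%VS = {:L}%VS.

Definition sub_cyclotomic (K : fieldExtType rat) (m : nat) : Prop :=
  exists2 L : fieldExtType rat, is_cyclotomic m L & inhabited 'AHom(K, L).

(* [Q(zeta_m) : K] = e, for K embedded in Q(zeta_m); the embedding is
   irrelevant, as all of them have the same image. *)
Definition cyclotomic_codegree (K : fieldExtType rat) (m e : nat) : Prop :=
  exists2 L : fieldExtType rat, is_cyclotomic m L &
  exists f : 'AHom(K, L), \dim_(limg f) {:L} = e.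

Definition is_conductor (K : fieldExtType rat) (m : nat) : Prop :=
  [/\ (0 < m)%N, sub_cyclotomic K m &
      forall m', (0 < m')%N -> sub_cyclotomic K m' -> (m <= m')%N].

(* Least m >= 1 such that K embeds in Q(zeta_m); 0 exactly when K is in no
   cyclotomic field. *)
Definition nf_conductor (K : fieldExtType rat) : nat :=
  xget 0%N [set m | is_conductor K m].

Record oddPrimePowerAbelian : Type := OddPrimePowerAbelian {
  opp_field :> splittingFieldType rat;
  opp_galois : galois 1 {:opp_field};
  opp_abelian : abelian 'Gal({:opp_field} / 1);
  opp_conductor : exists p r : nat,
    [/\ prime p, odd p, (1 <= r)%N & nf_conductor opp_field = (p ^ r)%N]
}.

(* The conductor is a prime power, so its least prime divisor is the only one. *)
Definition opp_prime (K : oddPrimePowerAbelian) : nat := pdiv (nf_conductor K).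

Definition opp_val (K : oddPrimePowerAbelian) : nat :=
  logn (opp_prime K) (nf_conductor K).

Definition lim_over (R : realType) (D : oddPrimePowerAbelian -> Prop)
    (inv : oddPrimePowerAbelian -> nat) (psi : oddPrimePowerAbelian -> R)
    (psi0 : R) : Prop :=
  forall e : R, 0 < e -> exists N : nat, forall K : oddPrimePowerAbelian,
    D K -> (N < inv K)%N -> `|psi K - psi0| < e.

(* Main.v *)
Require Import Defs.
From HB Require Import structures.
From mathcomp Require Import all_boot all_order all_fingroup all_algebra.
From mathcomp Require Import all_field.
From mathcomp Require Import all_classical all_reals ereal exp.
From mathcomp Require Import ring lra zify.
Import Order.TTheory GRing.Theory Num.Theory.
Set Implicit Arguments.
Unset Strict Implicit.
Unset Printing Implicit Defensive.
Local Open Scope classical_set_scope.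
Local Open Scope ring_scope.

(** Write [m = p ^ r] for the conductor of [K], [M = m / p], [w] for a primitive
    [m]-th root of unity, [n] for the degree of [K] and [e = [Q(w) : K]].

    An element of [K] is a rational combination [\sum_j a_j w^j] over [Z/m] whose
    coefficients are invariant under the subgroup [Hfix] of order [e] fixing [K];
    in these coordinates the trace form of [Q(w)] is
    [m \sum_j a_j^2 - M \sum_c (\sum_(p j = c) a_j)^2].  Since adding a constant to
    all coordinates changes nothing, one may round [a_j - s] instead of [a_j], and
    averaging over the shifts [s] yields an invariant rounding whose error has
    trace form at most [M^2 (p^2 - 1) / 12].  The arithmetic-geometric mean
    inequality turns this into [M(K)^2 <= (M (p + 1) / 12) ^ n].

    Minimality of the conductor makes [Hfix] act freely on the nonzero elements of
    [Z/m].  The ring of integers consists of the integral invariant combinations,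
    so comparing it with the lattice of all invariant integral functions, via a
    Schur complement, gives [p ^ (r n) <= D p ^ B] for [B = (M - 1) / e + 1].
    The theorem follows with [eps = r n / (r n - B)] and
    [C = sqrt ((p + 1) / (12 p))]. *)

(** The factor 1/12 is the variance of a uniform variable on an interval of length 1. On a block of
    [p] coordinates (a fibre of multiplication by [p]), [p \sum a^2] averages over the shifts to
    about [p^2 / 12]. The sum of the block is known modulo 1 and moves [p] times as fast as the
    shift, so its mean square is at least about 1/12. With finitely many shifts both estimates carry
    lower-order corrections, which cancel exactly and leave [p^2 - 1].

    The obstacle is that a proper subfield [K] has no basis of powers of [w]. Using all [m] powers
    is redundant, the relations being the functions constant on blocks, but [Hfix] then permutes the
    coordinates, so that rounding each coordinate separately preserves invariance. The discriminant
    bound has to remove this redundancy again: it adjoins the indicators of the blocks to a basis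
    and uses only that a nonzero integral determinant has square at least 1. Freeness of the action
    gives all orbits except that of 0 the same size [e], so the powers of [e] cancel and only powers
    of [p] remain. The oddness of [p] enters in the proof of freeness, through the divisibility of
    [p (p - 1) / 2] by [p]. *)

Section CenteredResidues.

(** Twice the deviation of the residue of [a] from the mean [(q - 1) / 2]; the factor 2 keeps it
    integral when [q] is even. Dividing by [2 q] gives the rounding error. *)
Definition cres (q : nat) (a : int) : int := 2 * (a %% q)%Z - (q%:Z - 1).

Lemma cresE q a : exists k : int, cres q a = 2 * a - (q%:Z - 1) + 2 * q%:Z * k.
Proof.
exists (- (a %/ q)%Z); rewrite /cres {2}[a](divz_eq a q); ring.
Qed.

Lemma cres_bounds q a : (0 < q)%N -> - (q%:Z - 1) <= cres q a <= q%:Z - 1.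
Proof.
move=> q0; rewrite /cres.
have h1 : 0 <= (a %% q)%Z by apply: modz_ge0; lia.
have h2 : (a %% q)%Z < q by apply: ltz_pmod; lia.
lia.
Qed.

Lemma sum_modz (V : zmodType) (F : int -> V) (q : nat) (a : int) : (0 < q)%N ->
  \sum_(s < q) F ((a - s%:Z) %% q)%Z = \sum_(s < q) F s%:Z.
Proof.
case: q => // q _.
pose f (s : 'I_q.+1) : 'I_q.+1 := inord `|((a - s%:Z) %% q.+1)%Z|.
have fE s : (f s)%:Z = ((a - s%:Z) %% q.+1)%Z.
  have h1 : 0 <= ((a - s%:Z) %% q.+1)%Z by apply: modz_ge0.
  have h2 : ((a - s%:Z) %% q.+1)%Z < q.+1 by apply: ltz_pmod.
  by rewrite /f inordK; lia.
have f_inj : injective f.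
  move=> s s' /(congr1 (fun i : 'I_q.+1 => i%:Z)); rewrite !fE => /eqP.
  rewrite eqz_mod_dvd => /dvdzP[k hk]; apply: val_inj => /=.
  have ls := ltn_ord s; have ls' := ltn_ord s'.
  have [k0|[k1|k1]] : k = 0 \/ (1 <= k \/ k <= -1) by lia.
  - by move: hk; rewrite k0 mul0r; lia.
  - have := ler_wpM2r (ler0n int q.+1) k1; lia.
  - have := ler_wpM2r (ler0n int q.+1) k1; lia.
rewrite [RHS](reindex_inj f_inj) /=; apply: eq_bigr => s _.
by rewrite fE.
Qed.

Lemma sum_modz_mul (V : zmodType) (F : int -> V) (p q : nat) (a : int) :
  (0 < q)%N ->
  \sum_(s < p * q) F ((a - s%:Z) %% q)%Z = (\sum_(s < q) F s%:Z) *+ p.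
Proof.
move=> q0; elim: p a => [|p IH] a; first by rewrite big_ord0 mulr0n.
rewrite mulSn big_split_ord /= sum_modz // mulrS; congr (_ + _).
rewrite -[RHS](IH a); apply: eq_bigr => s _; congr (F _).
have -> : a - (q + s)%N%:Z = (-1) * q%:Z + (a - s%:Z) by lia.
by rewrite modzMDl.
Qed.

Lemma sum_cres q : \sum_(s < q) (2 * s%:Z - (q%:Z - 1)) = 0.
Proof.
have h (a : int) (k : nat) :
    \sum_(s < k) (2 * s%:Z - a) = k%:Z * (k%:Z - 1) - k%:Z * a.
  elim: k => [|k IH]; first by rewrite big_ord0; ring.
  by rewrite big_ord_recr /= IH intS; ring.
by rewrite h; ring.
Qed.

Lemma sum_cres_sqr q :
  3 * \sum_(s < q) (2 * s%:Z - (q%:Z - 1)) ^+ 2 = q%:Z * (q%:Z ^+ 2 - 1).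
Proof.
(* The centre [a] is decoupled from the number [k] of terms to make induction possible. *)
have h (a : int) (k : nat) : 3 * \sum_(s < k) (2 * s%:Z - a) ^+ 2 =
    2 * k%:Z * (k%:Z - 1) * (2 * k%:Z - 1) - 6 * a * k%:Z * (k%:Z - 1)
      + 3 * k%:Z * a ^+ 2.
  elim: k => [|k IH]; first by rewrite big_ord0; ring.
  by rewrite big_ord_recr /= mulrDr IH intS; ring.
by rewrite h; ring.
Qed.

Lemma sqr_le_shift (q x k : int) : - q <= x <= q -> x ^+ 2 <= (x + 2 * q * k) ^+ 2.
Proof.
move=> /andP[hx1 hx2]; have q0 : 0 <= q by lia.
have -> : (x + 2 * q * k) ^+ 2 = x ^+ 2 + 4 * ((q * k) * (x + q * k)) by ring.
rewrite lerDl mulr_ge0 //.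
have [k0|[k1|k1]] : k = 0 \/ (1 <= k \/ k <= -1) by lia.
- by rewrite k0 mulr0 mul0r.
- by have := ler_wpM2l q0 k1; rewrite mulr1 => h; apply: mulr_ge0; lia.
- by have := ler_wpM2l q0 k1; rewrite mulrN1 => h; apply: mulr_le0; lia.
Qed.

(* The residues [c - p s] modulo [p q1] are equidistributed with spacing [p];
   the sum of squares of such a system of representatives is least when it is
   centred. *)
Lemma sum_sqr_ge (p q1 : nat) (S : nat -> int) (c : int) :
    (0 < p)%N -> (0 < q1)%N ->
    (forall s : nat, exists k, S s = c - 2 * p%:Z * s%:Z + 2 * (p * q1)%N%:Z * k) ->
  (p * q1)%N%:Z * ((p * q1)%N%:Z ^+ 2 - p%:Z ^+ 2)
    <= 3 * \sum_(s < p * q1) S s ^+ 2.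
Proof.
move=> p0 q10 hS.
(* Division by [2 p] splits [c] into the offset of a centred progression of step [2 p] and a
   remainder [d] with [|d| <= p]. *)
pose d0 := c + p%:Z * q1%:Z.
pose c1 := (d0 %/ (2 * p)%N)%Z.
pose d := (d0 %% (2 * p)%N)%Z - p%:Z.
have hd : - p%:Z <= d <= p%:Z.
  have h1 : 0 <= (d0 %% (2 * p)%N)%Z by apply: modz_ge0; lia.
  have h2 : (d0 %% (2 * p)%N)%Z < (2 * p)%N by apply: ltz_pmod; lia.
  by rewrite /d; lia.
have hc : c = 2 * p%:Z * c1 - p%:Z * (q1%:Z - 1) + d.
  have e0 := divz_eq d0 (2 * p)%N; rewrite -/c1 in e0.
  rewrite /d; move: e0; rewrite /d0 PoszM; lia.
pose w (s : nat) := cres q1 (c1 - s%:Z).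
(* Since [|p w s + d| <= p q1], this is a representative of least absolute value of the class of
   [S s] modulo [2 p q1]. *)
have le1 (s : nat) : (p%:Z * w s + d) ^+ 2 <= S s ^+ 2.
  have [k ->] := hS s; have [k' hk'] := cresE q1 (c1 - s%:Z).
  have -> : c - 2 * p%:Z * s%:Z + 2 * (p * q1)%N%:Z * k =
     (p%:Z * w s + d) + 2 * (p * q1)%N%:Z * (k - k').
    by rewrite /w hk' hc PoszM; ring.
  apply: sqr_le_shift; rewrite PoszM.
  have /andP[b1 b2] := cres_bounds (c1 - s%:Z) q10; rewrite -/(w s) in b1 b2.
  have hp : 0 <= p%:Z by [].
  have := ler_wpM2l hp b1; have := ler_wpM2l hp b2; lia.
have sw : \sum_(s < p * q1) w s = 0.
  rewrite /w /cres (sum_modz_mul (fun x => 2 * x - (q1%:Z - 1))) //.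
  by rewrite sum_cres mul0rn.
have sw2 : 3 * \sum_(s < p * q1) w s ^+ 2 = p%:Z * (q1%:Z * (q1%:Z ^+ 2 - 1)).
  rewrite /w /cres (sum_modz_mul (fun x => (2 * x - (q1%:Z - 1)) ^+ 2)) //.
  by rewrite mulrnAr sum_cres_sqr -mulr_natl natz.
have le2 : \sum_(s < p * q1) (p%:Z * w s + d) ^+ 2 <= \sum_(s < p * q1) S s ^+ 2.
  by apply: ler_sum => s _.
have : p%:Z ^+ 2 * \sum_(s < p * q1) w s ^+ 2 <=
    \sum_(s < p * q1) (p%:Z * w s + d) ^+ 2.
  (* The cross term vanishes because the [w s] sum to 0, and the [d ^ 2] term can only increase the
     total. *)
  have -> : \sum_(s < p * q1) (p%:Z * w s + d) ^+ 2 =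
     p%:Z ^+ 2 * \sum_(s < p * q1) w s ^+ 2 + 2 * p%:Z * d * \sum_(s < p * q1) w s
      + (p * q1)%N%:Z * d ^+ 2.
    have -> : (p * q1)%N%:Z * d ^+ 2 = \sum_(s < p * q1) d ^+ 2.
      by rewrite sumr_const card_ord -mulr_natl natz.
    rewrite !mulr_sumr -!big_split /=.
    by apply: eq_bigr => s _; ring.
  rewrite sw mulr0 addr0 lerDl; apply: mulr_ge0 => //; exact: sqr_ge0.
move: le2; set X := \sum_(s < _) _; set Y := \sum_(s < _) _; set Z := \sum_(s < _) _ in sw2 *.
move=> h1 h2; rewrite PoszM.
have -> : p%:Z * q1%:Z * ((p%:Z * q1%:Z) ^+ 2 - p%:Z ^+ 2) = 3 * (p%:Z ^+ 2 * Z).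
  by rewrite mulrCA sw2; ring.
lia.
Qed.

(** Each single residue runs once through all classes, so the squares contribute exactly
    [p^2 q (q^2 - 1)]. The block sum moves by [-2 p] per shift modulo [2 q], so its squares
    contribute at least [q (q^2 - p^2)] by [sum_sqr_ge]. The terms [p^2 q] cancel in the
    difference. *)
Lemma sum_cres_form_le (I : finType) (P : pred I) (p q q1 : nat) (A : I -> int) :
    #|P| = p -> (0 < p)%N -> (0 < q1)%N -> q = (p * q1)%N ->
  3 * \sum_(s < q) (p%:Z * \sum_(i | P i) cres q (A i - s%:Z) ^+ 2
         - (\sum_(i | P i) cres q (A i - s%:Z)) ^+ 2) <= q%:Z ^+ 3 * (p%:Z ^+ 2 - 1).
Proof.
move=> cP p0 q10 hq; have q0 : (0 < q)%N by rewrite hq muln_gt0 p0.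
rewrite sumrB mulrBr -mulr_sumr exchange_big /=.
have -> : \sum_(i | P i) \sum_(s < q) cres q (A i - s%:Z) ^+ 2 =
     \sum_(i | P i) \sum_(s < q) (2 * s%:Z - (q%:Z - 1)) ^+ 2.
  apply: eq_bigr => i _.
  exact: (@sum_modz _ (fun x => (2 * x - (q%:Z - 1)) ^+ 2)).
rewrite sumr_const cP -[X in _ * (_ * X) - _]mulr_natl natz mulrCA.
rewrite [3 * (_ * _)]mulrCA sum_cres_sqr.
have := @sum_sqr_ge p q1 (fun s => \sum_(i | P i) cres q (A i - s%:Z))
  (\sum_(i | P i) (2 * A i - (q%:Z - 1))) p0 q10.
rewrite -hq; set X := \sum_(s < q) _ => hX.
suff /hX : forall s : nat, exists k : int, \sum_(i | P i) cres q (A i - s%:Z) =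
    \sum_(i | P i) (2 * A i - (q%:Z - 1)) - 2 * p%:Z * s%:Z + 2 * q%:Z * k by lia.
move=> s.

have [k hk] := choice (fun i => cresE q (A i - s%:Z)).
exists (\sum_(i | P i) k i); rewrite mulr_sumr.
rewrite (eq_bigr (fun i => (2 * A i - (q%:Z - 1)) + 2 * q%:Z * k i - 2 * s%:Z)).
  rewrite big_split /= big_split /= sumr_const cP -[_ *+ p]mulr_natl [p%:R]natz; ring.
by move=> i _; rewrite hk; ring.
Qed.

End CenteredResidues.

(** * Gram determinants of integral functions modulo those constant on blocks *)

Section LatticeDeterminant.

Variables (F : numFieldType) (n : nat) (J B : finType).
Variables (w : J -> nat) (blk : J -> B) (beta : 'I_n -> J -> int).
Hypothesis cardJ : #|J| = (n + #|B|)%N.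
Hypothesis w_gt0 : forall j, (0 < w j)%N.
Hypothesis blk_surj : forall b, exists j, blk j = b.

Definition block_weight (b : B) : nat := \sum_(j | blk j == b) w j.

(** The Gram matrix, for the weights [w], of the projections of the [beta i] orthogonal to the
    functions constant on every block. *)
Definition block_form : 'M[F]_n := \matrix_(i, k)
  (\sum_j (w j)%:R * (beta i j)%:~R * (beta k j)%:~R
   - \sum_b (\sum_(j | blk j == b) (w j)%:R * (beta i j)%:~R)
       * (\sum_(j | blk j == b) (w j)%:R * (beta k j)%:~R) / (block_weight b)%:R).

Let Jv (j : 'I_(n + #|B|)) : J := enum_val (cast_ord (esym cardJ) j).

Let Jv_bij : bijective Jv.
Proof.
exists (fun j => cast_ord cardJ (enum_rank j)) => j; rewrite /Jv.
  by rewrite enum_valK cast_ordKV.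
by rewrite cast_ordK enum_rankK.
Qed.

Let sum_Jv (V : nmodType) (G : J -> V) : \sum_j G (Jv j) = \sum_j G j.
Proof. by rewrite [RHS](reindex Jv (onW_bij _ Jv_bij)). Qed.

Let prod_Jv (G : J -> F) : \prod_j G (Jv j) = \prod_j G j.
Proof. by rewrite [RHS](reindex Jv (onW_bij _ Jv_bij)). Qed.

Let sum_Bv (V : nmodType) (G : B -> V) : \sum_(b < #|B|) G (enum_val b) = \sum_b G b.
Proof. by rewrite [RHS](reindex enum_val (onW_bij _ (@enum_val_bij B))). Qed.

Let prod_Bv (G : B -> F) : \prod_(b < #|B|) G (enum_val b) = \prod_b G b.
Proof. by rewrite [RHS](reindex enum_val (onW_bij _ (@enum_val_bij B))). Qed.

(** The [beta i] stacked on the indicators of the blocks form a square integral matrix [E]. Its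
    weighted Gram determinant is [det E ^ 2] times the product of the weights; eliminating the block
    rows, it is also [det block_form] times the product of the block weights. Finally [det E] is a
    nonzero integer. *)
Lemma det_block_form_ge :
  \det block_form != 0 ->
  \prod_j (w j)%:R <= \det block_form * \prod_b (block_weight b)%:R.
Proof.
move=> nz.
pose E1 : 'M[int]_(n, n + #|B|) := \matrix_(i, j) beta i (Jv j).
pose E2 : 'M[int]_(#|B|, n + #|B|) := \matrix_(b, j) ((blk (Jv j) == enum_val b)%:Z).
pose E := col_mx E1 E2; pose EF := map_mx (intr : int -> F) E.
pose F1 := map_mx (intr : int -> F) E1; pose F2 := map_mx (intr : int -> F) E2.
pose W : 'rV[F]_(n + #|B|) := \row_j (w (Jv j))%:R.
pose WB : 'rV[F]_#|B| := \row_b (block_weight (enum_val b))%:R.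
have bw_gt0 b : (0 < block_weight b)%N.
  have [j hj] := blk_surj b; rewrite /block_weight (bigD1 j) ?hj //=.
  by rewrite addn_gt0 w_gt0.
pose WI : 'rV[F]_#|B| := \row_b ((block_weight (enum_val b))%:R)^-1.
have EFE : EF = col_mx F1 F2 by rewrite /EF /E map_col_mx.
have Z_E : F2 *m diag_mx W *m F2^T = diag_mx WB.
  apply/matrixP => b b'; rewrite mul_mx_diag !mxE.
  under eq_bigr => j _ do rewrite !mxE.
  rewrite (sum_Jv (fun j => (blk j == enum_val b)%:~R * (w j)%:R
      * (blk j == enum_val b')%:~R)).
  have [->|neq] := eqVneq b b'.
    rewrite mulr1n /block_weight natr_sum [RHS]big_mkcond /=.
    by apply: eq_bigr => j _; case: eqP => _; rewrite /= ?(mul1r, mulr1, mul0r).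
  rewrite mulr0n big1 // => j _.
  have [e1|_] := eqVneq (blk j) (enum_val b); last by rewrite !mul0r.
  rewrite e1 (inj_eq enum_val_inj) (negPf neq) mulr0 //.
have ZI : diag_mx WI *m diag_mx WB = 1%:M.
  rewrite mulmx_diag; apply/matrixP => b b'; rewrite !mxE mulVf //.
  by rewrite pnatr_eq0 -lt0n.
pose X := F1 *m diag_mx W *m F1^T; pose Y := F1 *m diag_mx W *m F2^T.
have blockE : EF *m diag_mx W *m EF^T = block_mx X Y Y^T (diag_mx WB).
  rewrite EFE mul_col_mx tr_col_mx mul_col_row -Z_E; congr (block_mx _ _ _ _).
  by rewrite /Y !trmx_mul trmxK tr_diag_mx mulmxA.
have YE i b : Y i b = \sum_(j | blk j == enum_val b) (w j)%:R * (beta i j)%:~R.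
  rewrite /Y mul_mx_diag mxE; under eq_bigr => j _ do rewrite !mxE.
  rewrite (sum_Jv (fun j => (beta i j)%:~R * (w j)%:R * (blk j == enum_val b)%:~R)).
  rewrite [RHS]big_mkcond /=; apply: eq_bigr => j _.
  by case: eqP => _; rewrite ?mulr1 ?mulr0 // mulrC.
have schur : X - Y *m diag_mx WI *m Y^T = block_form.
  apply/matrixP => i k; rewrite mul_mx_diag !mxE; congr (_ - _).
    under eq_bigr => j _ do rewrite mul_mx_diag !mxE.
    rewrite (sum_Jv (fun j => (beta i j)%:~R * (w j)%:R * (beta k j)%:~R)).
    by apply: eq_bigr => j _; rewrite (mulrC (_%:~R)).
  rewrite -(sum_Bv (fun b => (\sum_(j | blk j == b) (w j)%:R * (beta i j)%:~R)
       * (\sum_(j | blk j == b) (w j)%:R * (beta k j)%:~R) / (block_weight b)%:R)).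
  apply: eq_bigr => b _; rewrite [in LHS]mxE [Y^T _ _]mxE !YE [WI _ _]mxE.
  by rewrite mulrAC.
have detE : \det EF ^+ 2 * \prod_j (w j)%:R =
    \det block_form * \prod_b (block_weight b)%:R.
  have := congr1 determinant blockE.
  rewrite !det_mulmx det_tr det_diag.
  have -> : \det (block_mx X Y Y^T (diag_mx WB)) = \det block_form * \det (diag_mx WB).
    rewrite -schur.
    have -> : \det (block_mx X Y Y^T (diag_mx WB)) =
        \det (block_mx 1%:M (- (Y *m diag_mx WI)) 0 1%:M *m
          block_mx X Y Y^T (diag_mx WB)).
      by rewrite det_mulmx det_ublock !det1 !mul1r.
    rewrite mulmx_block !mul1mx !mul0mx !add0r !mulNmx.
    by rewrite -(mulmxA Y (diag_mx WI) (diag_mx WB)) ZI mulmx1 subrr det_lblock.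
  rewrite det_diag; under [\prod_j W 0 j]eq_bigr => j _ do rewrite mxE.
  rewrite (prod_Jv (fun j => (w j)%:R)).
  under [\prod_j WB 0 j]eq_bigr => j _ do rewrite mxE.
  by rewrite (prod_Bv (fun b => (block_weight b)%:R)) expr2 mulrAC => <-.
rewrite -detE; have dE : \det EF = (\det E)%:~R by rewrite /EF det_map_mx.
have nzE : \det E != 0.
  apply: contra_neq nz => dE0; apply/eqP; move/eqP: detE.
  rewrite dE dE0 expr0n mul0r eq_sym mulf_eq0 => /orP[//|].
  move=> /prodf_eq0[b _]; rewrite pnatr_eq0 => h; move: (bw_gt0 b); by rewrite (eqP h).
have p0 : 0 <= \prod_j (w j)%:R :> F by apply: prodr_ge0 => j _; exact: ler0n.
rewrite -[leLHS]mul1r; apply: ler_wpM2r => //.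
rewrite dE -rmorphXn /= -[1]/(1%:~R) ler_int.
by move: nzE; set d := \det E; nia.
Qed.

End LatticeDeterminant.

(** * Characters, automorphisms and the trace form of [Q(w)] *)

Section CyclotomicSums.

Variables (p r : nat).
Hypotheses (p_pr : prime p) (r_gt0 : (0 < r)%N).
Let m := (p ^ r)%N.
Let M := (p ^ r.-1)%N.
Variable w : algC.
Hypothesis prim_w : m.-primitive_root w.

Let p_gt1 : (1 < p)%N := prime_gt1 p_pr.

Lemma ppow_mul : m = (p * M)%N.
Proof. by rewrite /m /M -expnS prednK. Qed.

Lemma ppow_gt1 : (1 < m)%N.
Proof. by rewrite /m -(expn0 p) ltn_exp2l. Qed.

Let M_gt0 : (0 < M)%N. Proof. by rewrite expn_gt0 prime_gt0. Qed.

Let m_cast : (Zp_trunc m).+2 = m := Zp_cast ppow_gt1.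

(** Indexing by the ring ['Z_m] turns Galois conjugation into multiplication of the index by a
    unit. *)
Definition zchar (j : 'Z_m) : algC := w ^+ j.
Local Notation chi := zchar.

Lemma zchar_nat (k : nat) : chi k%:R = w ^+ k.
Proof. by rewrite /chi val_Zp_nat ?ppow_gt1 // prim_expr_mod. Qed.

Lemma zcharD j k : chi (j + k) = chi j * chi k.
Proof. by rewrite -[j]natr_Zp -[k]natr_Zp -natrD !zchar_nat exprD. Qed.

Lemma zchar0 : chi 0 = 1. Proof. by rewrite /chi expr0. Qed.

Lemma zcharMn j k : chi (j *+ k) = chi j ^+ k.
Proof. by elim: k => [|k IH]; rewrite ?zchar0 // mulrS zcharD IH exprS. Qed.

Lemma zcharM j k : chi (j * k) = chi k ^+ j.
Proof. by rewrite -{1}[j]natr_Zp mulr_natl zcharMn. Qed.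

Lemma zchar_neq0 j : chi j != 0.
Proof. by rewrite expf_neq0 // (prim_root_eq0 prim_w) -lt0n (ltnW ppow_gt1). Qed.

Lemma zcharN j : chi (- j) = (chi j)^-1.
Proof. by apply: (mulfI (zchar_neq0 j)); rewrite -zcharD subrr zchar0 divff // zchar_neq0. Qed.

Lemma conj_zchar j : (chi j)^* = chi (- j).
Proof.
have h : chi j ^+ m = 1 by rewrite /chi exprAC (prim_expr_order prim_w) expr1n.
have n1 : `|chi j| = 1.
  apply: (@pexpIrn _ m); rewrite ?nnegrE ?normr_ge0 ?ler01 //.
    exact: ltnW ppow_gt1.
  by rewrite -normrX h normr1 expr1n.
apply: (mulfI (zchar_neq0 j)); rewrite zcharN divff ?zchar_neq0 //.
by rewrite -normCK n1 expr1n.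
Qed.

Lemma zchar_inj : injective chi.
Proof.
move=> j k /eqP; rewrite (eq_prim_root_expr prim_w) => /eqP e.
by apply: val_inj; move: e; rewrite !modn_small // -[X in (_ < X)%N]m_cast.
Qed.

Lemma zchar_eq1 j : (chi j == 1) = (j == 0).
Proof. by rewrite -zchar0 (inj_eq zchar_inj). Qed.

Lemma pM_Zp : p%:R * M%:R = 0 :> 'Z_m.
Proof. by rewrite -natrM -ppow_mul pchar_Zp ?ppow_gt1. Qed.

Lemma M_Zp_neq0 : M%:R != 0 :> 'Z_m.
Proof.
apply/eqP => /(congr1 val) /=; rewrite val_Zp_nat ?ppow_gt1 // modn_small.
  by move=> e; move: M_gt0; rewrite e.
by rewrite ppow_mul -[X in (X < _)%N]mul1n ltn_pmul2r.
Qed.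

(** Translation by [d] multiplies the sum by [chi d], which is not 1. *)
Lemma sum_zchar_shift (P : pred 'Z_m) d : d != 0 ->
  (forall j, P (d + j) = P j) -> \sum_(j | P j) chi j = 0.
Proof.
move=> d0 hP; apply/eqP; rewrite -(@mulIr_eq0 _ (chi d - 1)); last first.
  by apply/mulIf; rewrite subr_eq0 zchar_eq1.
rewrite mulrBr mulr1 mulr_suml [X in _ - X](reindex_inj (addrI d)) /= subr_eq0.
apply/eqP; rewrite [RHS](eq_bigl P) //.
by apply: eq_bigr => j _; rewrite zcharD mulrC.
Qed.

Lemma sum_zchar_block c : \sum_(j | p%:R * j == c) chi j = 0.
Proof.
by apply: (sum_zchar_shift M_Zp_neq0) => j; rewrite mulrDr pM_Zp add0r.
Qed.

Lemma sum_zchar : \sum_j chi j = 0.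
Proof. exact: (sum_zchar_shift (P := xpredT) M_Zp_neq0). Qed.

Lemma sum_zcharM j : \sum_k chi (k * j) = (m * (j == 0))%:R.
Proof.
have [->|j0] := eqVneq j 0.
  under eq_bigr do rewrite mulr0 zchar0.
  by rewrite sumr_const card_ord muln1 m_cast.
rewrite muln0; apply/eqP; rewrite -(@mulIr_eq0 _ (chi j - 1)); last first.
  by apply/mulIf; rewrite subr_eq0 zchar_eq1.
rewrite mulrBr mulr1 mulr_suml [X in _ - X](reindex_inj (addrI 1)) /= subr_eq0.
by apply/eqP; apply: eq_bigr => k _; rewrite mulrDl mul1r zcharD mulrC.
Qed.

Lemma Zp_unit_dvd (k : 'Z_m) : (k \is a GRing.unit) = ~~ (p %| k)%N.
Proof.
rewrite -{1}[k]natr_Zp unitZpE ?ppow_gt1 // /m coprime_pexpl //.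
by rewrite prime_coprime.
Qed.

Lemma big_nonunit (A : Type) (idx : A) (op : Monoid.com_law idx) (G : 'Z_m -> A) :
  \big[op/idx]_(k : 'Z_m | k \isn't a GRing.unit) G k =
  \big[op/idx]_(i < M) G (p * i)%:R.
Proof.
pose f (i : 'I_M) : 'Z_m := (p * i)%:R.
have fval (i : 'I_M) : f i = (p * i)%N :> nat.
  by rewrite /f val_Zp_nat ?ppow_gt1 // modn_small // ppow_mul ltn_pmul2l // ltnW.
have f_inj : injective f.
  move=> i i' /(congr1 (@nat_of_ord _)); rewrite !fval => /eqP.
  by rewrite eqn_pmul2l ?(ltnW p_gt1) // => /eqP /val_inj.
rewrite (eq_bigl (mem (f @: [set: 'I_M]%SET))); last first.
  move=> k; rewrite Zp_unit_dvd negbK; apply/idP/imsetP => [hk|[i _ ->]].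
    have lt : (k %/ p < M)%N.
      rewrite ltn_divLR ?(ltnW p_gt1) // mulnC -ppow_mul -[X in (_ < X)%N]m_cast.
      exact: ltn_ord.
    exists (Ordinal lt) => //; apply: ord_inj; rewrite fval /=.
    by rewrite mulnC divnK.
  by rewrite fval dvdn_mulr.
rewrite big_imset /=; last by move=> x y _ _; exact: f_inj.
by apply: eq_bigl => i; rewrite inE.
Qed.

Lemma sum_zcharM_nonunit j :
  \sum_(k : 'Z_m | k \isn't a GRing.unit) chi (k * j) = (M * (p%:R * j == 0))%:R.
Proof.
have -> : \sum_(k : 'Z_m | k \isn't a GRing.unit) chi (k * j) =
    \sum_(i < M) chi (p%:R * j) ^+ i.
  rewrite big_nonunit; apply: eq_bigr => i _; rewrite -zcharMn; congr (chi _).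
  by rewrite natrM -[RHS]mulr_natl mulrA [i%:R * _]mulrC.
have [->|j0] := eqVneq (p%:R * j) 0.
  rewrite zchar0; under eq_bigr do rewrite expr1n.
  by rewrite sumr_const card_ord muln1.
have c1 : chi (p%:R * j) - 1 != 0 by rewrite subr_eq0 zchar_eq1.
apply/eqP; rewrite muln0 -(@mulrI_eq0 _ (chi (p%:R * j) - 1)); last by exact/mulfI.
have e0 : (p%:R * j) *+ M = 0 :> 'Z_m.
  by rewrite -mulr_natl mulrA [_ * p%:R]mulrC pM_Zp mul0r.
by rewrite -subrX1 -zcharMn e0 zchar0 subrr.
Qed.

Lemma big_unit (A : Type) (idx : A) (op : Monoid.com_law idx) (G : 'Z_m -> A) :
  \big[op/idx]_(u : {unit 'Z_m}) G (val u) =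
  \big[op/idx]_(k : 'Z_m | k \is a GRing.unit) G k.
Proof.
rewrite [RHS](reindex_onto (val : {unit 'Z_m} -> 'Z_m) (insubd (1%g : {unit 'Z_m}))) /=.
  apply: eq_bigl => u; rewrite valKd eqxx andbT; symmetry; exact: (valP u).
by move=> k hk; rewrite insubdK.
Qed.

(** Ramanujan sums for a prime power modulus: the sum over all residues minus the sum over the
    non-units. *)
Lemma sum_zchar_unit j :
  \sum_(u : {unit 'Z_m}) chi (val u * j) =
    (m * (j == 0))%:R - (M * (p%:R * j == 0))%:R.
Proof.
rewrite (big_unit _ (fun k => chi (k * j))) -sum_zcharM -sum_zcharM_nonunit.
by rewrite [X in _ = X - _](bigID (fun k : 'Z_m => k \is a GRing.unit)) /= addrK.
Qed.

Lemma Zp_unit_coprime (u : {unit 'Z_m}) : coprime (val u) m.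
Proof.
have := valP u; rewrite -{1}[val u]natr_Zp /= unitZpE ?ppow_gt1 // coprime_sym.
by [].
Qed.

(** A chosen extension to [algC]. Only its restriction to [Q(w)] is determined by [u], whence the
    [inQw] hypotheses in [tau_mul], [tau_one] and [tau_conj]. *)
Definition tau (u : {unit 'Z_m}) : {rmorphism algC -> algC} :=
  sval (Qn_aut_exists (Zp_unit_coprime u)).

Lemma tau_zchar u j : tau u (chi j) = chi (val u * j).
Proof.
rewrite /tau; case: (Qn_aut_exists _) => f /= ->; first by rewrite zcharM.
by rewrite /chi exprAC (prim_expr_order prim_w) expr1n.
Qed.

Definition inQw (x : algC) : Prop :=
  exists q : 'Z_m -> rat, x = \sum_j ratr (q j) * chi j.

Lemma inQw_zchar j : inQw (chi j).
Proof.
exists (fun k => (k == j)%:R); rewrite (bigD1 j) //= eqxx rmorph1 mul1r.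
by rewrite big1 ?addr0 // => k /negPf->; rewrite rmorph0 mul0r.
Qed.

Lemma inQwD x y : inQw x -> inQw y -> inQw (x + y).
Proof.
move=> [q ->] [q' ->]; exists (fun j => q j + q' j).
by rewrite -big_split; apply: eq_bigr => j _; rewrite rmorphD mulrDl.
Qed.

Lemma inQwZ a x : inQw x -> inQw (ratr a * x).
Proof.
move=> [q ->]; exists (fun j => a * q j).
by rewrite mulr_sumr; apply: eq_bigr => j _; rewrite rmorphM mulrA.
Qed.

Lemma inQw0 : inQw 0.
Proof. by rewrite -(mul0r (chi 0)) -(rmorph0 (ratr : rat -> algC)); apply/inQwZ/inQw_zchar. Qed.

Lemma inQw_sum (I : Type) (s : seq I) (P : pred I) (F : I -> algC) :
  (forall i, P i -> inQw (F i)) -> inQw (\sum_(i <- s | P i) F i).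
Proof. by move=> h; elim/big_rec: _ => [|i x Pi hx]; [exact: inQw0 | apply: inQwD hx; exact: h]. Qed.

Lemma inQwM x y : inQw x -> inQw y -> inQw (x * y).
Proof.
move=> [q ->] [q' ->]; rewrite mulr_suml; apply: inQw_sum => j _.
rewrite mulr_sumr; apply: inQw_sum => k _.
rewrite mulrACA -zcharD -rmorphM; exact/inQwZ/inQw_zchar.
Qed.

Lemma tau_comb u (q : 'Z_m -> rat) :
  tau u (\sum_j ratr (q j) * chi j) = \sum_j ratr (q j) * chi (val u * j).
Proof.
by rewrite rmorph_sum; apply: eq_bigr => j _; rewrite rmorphM fmorph_rat tau_zchar.
Qed.

Lemma tau_mul u v x : inQw x -> tau u (tau v x) = tau (u * v)%g x.
Proof.
move=> [q ->]; rewrite !tau_comb rmorph_sum; apply: eq_bigr => j _.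
by rewrite rmorphM fmorph_rat tau_zchar mulrA.
Qed.

Lemma tau_one x : inQw x -> tau 1%g x = x.
Proof.
by move=> [q ->]; rewrite tau_comb; apply: eq_bigr => j _; rewrite /= mul1r.
Qed.

Lemma conj_comb (q : 'Z_m -> rat) :
  (\sum_j ratr (q j) * chi j)^* = \sum_j ratr (q j) * chi (- j).
Proof.
rewrite rmorph_sum; apply: eq_bigr => j _.
by rewrite rmorphM /= conj_zchar conj_Crat ?Crat_rat.
Qed.

Lemma tau_conj u x : inQw x -> tau u x^* = (tau u x)^*.
Proof.
move=> [q ->]; rewrite conj_comb tau_comb [LHS]rmorph_sum [RHS]rmorph_sum.
apply: eq_bigr => j _; rewrite [LHS]rmorphM [RHS]rmorphM /= fmorph_rat tau_zchar.
by rewrite conj_Crat ?Crat_rat // conj_zchar mulrN.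
Qed.

Definition TrQw (x : algC) : algC := \sum_u tau u x.
Local Notation T := TrQw.

Lemma TrQwZ a x : T (ratr a * x) = ratr a * T x.
Proof. by rewrite /T mulr_sumr; apply: eq_bigr => u _; rewrite rmorphM fmorph_rat. Qed.

Lemma TrQw_sum (I : Type) (s : seq I) (P : pred I) (F : I -> algC) :
  T (\sum_(i <- s | P i) F i) = \sum_(i <- s | P i) T (F i).
Proof.
by rewrite /T exchange_big /=; apply: eq_bigr => u _; rewrite rmorph_sum.
Qed.

Lemma TrQw_zchar j : T (chi j) = (m * (j == 0))%:R - (M * (p%:R * j == 0))%:R.
Proof. by rewrite -sum_zchar_unit; apply: eq_bigr => u _; rewrite tau_zchar. Qed.

Lemma TrQw_tau h x : inQw x -> T (tau h x) = T x.
Proof.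
move=> hx; rewrite /T [RHS](reindex_inj (mulIg h)).
by apply: eq_bigr => u _; rewrite tau_mul.
Qed.

Lemma TrQw_rat x : inQw x -> T x \in Crat.
Proof.
move=> [q ->]; rewrite TrQw_sum; apply: rpred_sum => j _.
rewrite TrQwZ TrQw_zchar rpredM ?Crat_rat // rpredB //; exact: rpred_nat.
Qed.

(** A Fourier inversion. Each coefficient trace is [m] times the coefficient minus a term constant
    on blocks, and the latter disappears because [chi] sums to 0 over a block. Unlike the
    coefficients in [inQw], these traces are canonical. *)
Lemma inQw_inv x : inQw x -> m%:R * x = \sum_j T (x * chi (- j)) * chi j.
Proof.
move=> [q ->]; rewrite mulr_sumr.
under [RHS]eq_bigr => j _.
  rewrite [_ * chi (- j)]mulr_suml TrQw_sum mulr_suml.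
  under eq_bigr => k _ do rewrite -mulrA TrQwZ -zcharD.
  over.
rewrite exchange_big /=; apply: eq_bigr => k _.
under eq_bigr => j _ do rewrite -mulrA TrQw_zchar mulrBl mulrBr.
rewrite sumrB -[LHS]subr0 mulrCA; congr (_ - _).
  rewrite (bigD1 k) //= subrr eqxx muln1 big1 ?addr0 // => j jk.
  by rewrite subr_eq0 eq_sym (negPf jk) muln0 mul0r mulr0.
symmetry; rewrite (bigID (fun j => p%:R * j == p%:R * k)) /=.
rewrite [X in _ + X]big1 ?addr0; last first.
  move=> j jk; rewrite mulrBr subr_eq0 eq_sym (negPf jk) muln0 mul0r mulr0 //.
transitivity (\sum_(j | p%:R * j == p%:R * k) ratr (q k) * M%:R * chi j).
  by apply: eq_bigr => j jk; rewrite mulrBr subr_eq0 eq_sym jk muln1 mulrA.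
by rewrite -mulr_sumr sum_zchar_block mulr0.
Qed.

Definition cyc_form (a b : 'Z_m -> rat) : rat :=
  m%:R * \sum_j a j * b j - M%:R *
    \sum_c (\sum_(j | p%:R * j == c) a j) * (\sum_(j | p%:R * j == c) b j).

Lemma TrQw_form (a b : 'Z_m -> rat) :
  T ((\sum_j ratr (a j) * chi j) * (\sum_j ratr (b j) * chi j)^*) =
    ratr (cyc_form a b).
Proof.
rewrite conj_comb mulr_suml TrQw_sum.
transitivity (\sum_j \sum_k (ratr (a j * b k) *
    (m%:R * (j == k)%:R - M%:R * (p%:R * j == p%:R * k :> 'Z_m)%:R)) : algC).
  apply: eq_bigr => j _; rewrite mulr_sumr TrQw_sum; apply: eq_bigr => k _.
  rewrite mulrACA -zcharD -rmorphM TrQwZ TrQw_zchar subr_eq0 [p%:R * (_ - _)]mulrBr subr_eq0.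
  by rewrite !natrM.
rewrite /cyc_form rmorphB !rmorphM /= !ratr_nat !rmorph_sum /=.
under eq_bigr => j _ do under eq_bigr => k _ do rewrite mulrBr.
under eq_bigr => j _ do rewrite sumrB.
rewrite sumrB; congr (_ - _).
  rewrite mulr_sumr; apply: eq_bigr => j _; rewrite (bigD1 j) //= eqxx mulr1 mulrC.
  rewrite big1 ?addr0 // => k kj; rewrite eq_sym (negPf kj) !mulr0 //.
rewrite mulr_sumr.
rewrite (partition_big (fun j : 'Z_m => p%:R * j) xpredT) //=.
apply: eq_bigr => c _; rewrite rmorphM !rmorph_sum /= mulr_suml mulr_sumr.
apply: eq_bigr => j /eqP jc; rewrite mulr_sumr mulr_sumr [RHS]big_mkcond /=.
apply: eq_bigr => k _; rewrite jc eq_sym rmorphM.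
by case: eqP => _; rewrite ?mulr1 ?mulr0 //; rewrite mulrC.
Qed.

Lemma TrQw_norm x : inQw x -> T (x * x^*) = \sum_u `|tau u x| ^+ 2.
Proof.
by move=> hx; apply: eq_bigr => u _; rewrite rmorphM /= tau_conj // -normCK.
Qed.

(** This is the value at 1 of the cyclotomic polynomial [(X^m - 1) / (X^M - 1) = \sum_(i < p) X^(M
    i)]. *)
Lemma prod_unit_zchar : \prod_(u : {unit 'Z_m}) (1 - chi (val u)) = p%:R.
Proof.
pose L : {poly algC} := \prod_(u : {unit 'Z_m}) ('X - (chi (val u))%:P).
have nz : 'X^M - 1 != 0 :> {poly algC}.
  by rewrite -size_poly_eq0 size_XnsubC.
have hL : L * ('X^M - 1) = (\sum_(i < p) 'X^M ^+ i) * ('X^M - 1).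
  have prim_wp : M.-primitive_root (w ^+ p).
    have -> : p = (m %/ M)%N by rewrite ppow_mul mulnK.
    by apply: (dvdn_prim_root prim_w); rewrite ppow_mul dvdn_mull.
  rewrite [RHS]mulrC -subrX1 -exprM mulnC -ppow_mul.
  have -> : L = \prod_(k : 'Z_m | k \is a GRing.unit) ('X - (chi k)%:P).
    by rewrite /L (big_unit _ (fun k => 'X - (chi k)%:P)).
  have -> : 'X^M - 1 = \prod_(k : 'Z_m | k \isn't a GRing.unit) ('X - (chi k)%:P).
    rewrite big_nonunit -(factor_Xn_sub_1 prim_wp) big_mkord.
    by apply: eq_bigr => i _; rewrite zchar_nat exprM.
  rewrite -(factor_Xn_sub_1 prim_w) big_mkord.
  have -> : \prod_(i < m) ('X - (w ^+ i)%:P) = \prod_(i : 'Z_m) ('X - (chi i)%:P).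
    by rewrite -(big_mkord xpredT (fun i => 'X - (w ^+ i)%:P)) -{1}m_cast big_mkord.
  by rewrite [RHS](bigID (fun k : 'Z_m => k \is a GRing.unit)).
have {}hL : L = \sum_(i < p) 'X^M ^+ i by apply: (mulIf nz).
have := congr1 (fun P : {poly algC} => P.[1]) hL; rewrite /L horner_prod horner_sum.
under eq_bigr do rewrite !hornerE.
move=> ->; under eq_bigr do rewrite !hornerE !expr1n.
by rewrite sumr_const card_ord.
Qed.

Lemma mulr_regroup (R : comPzRingType) (a b y q v l : R) :
  a * (b * y * q) * v * l = y * (a * b * l * v) * q.
Proof. ring. Qed.

Lemma mulrD_regroup (R : comPzRingType) (b l q y z c : R) :
  l * (b * q + c * z) + q * y = l * c * z + q * (l * b + y).
Proof. ring. Qed.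

(** * The ring of integers of [Q(w)] is [Z[w]] *)

Definition inZw (x : algC) : Prop :=
  exists q : 'Z_m -> int, x = \sum_j (q j)%:~R * chi j.

Lemma inZw_zchar j : inZw (chi j).
Proof.
exists (fun k => (k == j)%:R); rewrite (bigD1 j) //= eqxx mul1r.
by rewrite big1 ?addr0 // => k /negPf->; rewrite mul0r.
Qed.

Lemma inZwD x y : inZw x -> inZw y -> inZw (x + y).
Proof.
move=> [q ->] [q' ->]; exists (fun j => q j + q' j).
by rewrite -big_split; apply: eq_bigr => j _; rewrite intrD mulrDl.
Qed.

Lemma inZwZ (a : int) x : inZw x -> inZw (a%:~R * x).
Proof.
move=> [q ->]; exists (fun j => a * q j).
by rewrite mulr_sumr; apply: eq_bigr => j _; rewrite intrM mulrA.
Qed.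

Lemma inZw_int (a : int) : inZw a%:~R.
Proof. by rewrite -[_%:~R]mulr1 -zchar0; apply/inZwZ/inZw_zchar. Qed.

Lemma inZw_sum (I : Type) (s : seq I) (P : pred I) (F : I -> algC) :
  (forall i, P i -> inZw (F i)) -> inZw (\sum_(i <- s | P i) F i).
Proof.
move=> h; elim/big_rec: _ => [|i x Pi hx]; first exact: (inZw_int 0).
by apply: inZwD hx; exact: h.
Qed.

Lemma inZwM x y : inZw x -> inZw y -> inZw (x * y).
Proof.
move=> [q ->] [q' ->]; rewrite mulr_suml; apply: inZw_sum => j _.
rewrite mulr_sumr; apply: inZw_sum => k _.
rewrite mulrACA -zcharD -intrM; exact/inZwZ/inZw_zchar.
Qed.

Lemma inZw_prod (I : Type) (s : seq I) (P : pred I) (F : I -> algC) :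
  (forall i, P i -> inZw (F i)) -> inZw (\prod_(i <- s | P i) F i).
Proof.
move=> h; elim/big_rec: _ => [|i x Pi hx]; first exact: (inZw_int 1).
by apply: inZwM hx; exact: h.
Qed.

Lemma inZwX x k : inZw x -> inZw (x ^+ k).
Proof.
by move=> hx; elim: k => [|k IH]; [exact: (inZw_int 1) | rewrite exprS; apply: inZwM].
Qed.

Lemma inZw_Aint x : inZw x -> x \in Aint.
Proof.
move=> [q ->]; apply: rpred_sum => j _; apply: rpredM; first exact: Aint_int.
by apply: rpredX; exact: Aint_prim_root prim_w.
Qed.

Let lam := 1 - w.
Let N := #|{: {unit 'Z_m}}|.

Let wE : w = chi 1. Proof. by rewrite -[1]/(1%:R) zchar_nat expr1. Qed.

(** With [p_factor_lam] this says that [p] is totally ramified: [lam] and each factor [1 - chi u] of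
    [p] divide one another in [Z[w]]. *)
Lemma lam_factor_p : exists2 v, inZw v & p%:R = lam ^+ N * v.
Proof.
exists (\prod_(u : {unit 'Z_m}) \sum_(i < val u) w ^+ i).
  apply: inZw_prod => u _; apply: inZw_sum => i _; rewrite wE; exact/inZwX/inZw_zchar.
rewrite -prod_unit_zchar /N -prodr_const -big_split; apply: eq_bigr => u _ /=.
by rewrite /lam /chi -opprB subrX1 -mulNr opprB.
Qed.

Lemma p_factor_lam : exists2 v, inZw v & lam ^+ N = p%:R * v.
Proof.
exists (\prod_(u : {unit 'Z_m}) \sum_(i < val u^-1%g) chi (val u) ^+ i).
  apply: inZw_prod => u _; apply: inZw_sum => i _; exact/inZwX/inZw_zchar.
rewrite -prod_unit_zchar /N -prodr_const -big_split; apply: eq_bigr => u _ /=.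
rewrite -opprB mulNr -subrX1 opprB -zcharM /lam wE; congr (1 - chi _).
by rewrite mulVr //; exact: (valP u).
Qed.

(** Every power of [w] is congruent to 1 modulo [lam]. *)
Lemma inZw_mod_lam x : inZw x -> exists2 y, inZw y & exists a : int, x = a%:~R + lam * y.
Proof.
move=> [q ->]; exists (\sum_j (- q j)%:~R * \sum_(i < j) w ^+ i).
  apply: inZw_sum => j _; apply: inZwZ; apply: inZw_sum => i _.
  rewrite wE; exact/inZwX/inZw_zchar.
exists (\sum_j q j); rewrite rmorph_sum mulr_sumr -big_split /=.
apply: eq_bigr => j _; set S := \sum_(i < j) _.
have sE : chi j = 1 + (w - 1) * S by rewrite -subrX1 addrC subrK.
by rewrite sE /lam rmorphN /=; ring.
Qed.

Let p_neq0 : p%:R != 0 :> algC. Proof. by rewrite pnatr_eq0 -lt0n ltnW. Qed.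

(** Modulo [p], one factor [lam] is extracted from [x] at a time, up to [lam ^ N], an associate of
    [p]. The residue modulo [lam] met on the way is an integer [a] with [a / lam] integral over [Z];
    then [a ^ N / p] is a rational algebraic integer, so [p] divides [a]. *)
Lemma inZw_div_p x : inZw x -> x / p%:R \in Aint -> inZw (x / p%:R).
Proof.
move=> hx hA; have [v hv pE] := lam_factor_p; have [v' hv' lE] := p_factor_lam.
have lam0 : lam != 0.
  apply: contraNneq p_neq0 => l0; rewrite pE l0 expr0n.
  suff -> : (N == 0%N) = false by rewrite mul0r.
  by apply/negbTE; rewrite -lt0n; apply/card_gt0P; exists 1%g.
have vv' : v' * v = 1.
  apply: (mulfI p_neq0); rewrite mulrA -lE -pE mulr1 //.
have N0 : (0 < N)%N by apply/card_gt0P; exists 1%g.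
have lA : lam \in Aint by rewrite rpredB ?Aint1 ?(Aint_prim_root prim_w).
(* The summand [p y'] collects the residues that turn out to be divisible by [p]. *)
suff /(_ N (leqnn N)) [y hy [y' hy' ->]] : forall k, (k <= N)%N ->
    exists2 y, inZw y & exists2 y', inZw y' & x = lam ^+ k * y + p%:R * y'.
  rewrite lE -mulrA -mulrDr [p%:R * _]mulrC mulfK //.
  by apply: inZwD => //; exact: inZwM.
elim=> [|k IH] kN.
  by exists x => //; exists 0; [exact: (inZw_int 0)|rewrite expr0 mul1r mulr0 addr0].
have [y hy [y' hy' xE]] := IH (ltnW kN).
have [z hz [a yE]] := inZw_mod_lam hy.
have aA : a%:~R / lam \in Aint.
  have h1 : lam ^+ k * y / p%:R \in Aint.
    have -> : lam ^+ k * y / p%:R = x / p%:R - y'.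
      by rewrite xE mulrDl [p%:R * _]mulrC mulfK // addrK.
    by rewrite rpredB // inZw_Aint.
  have -> : a%:~R / lam = lam ^+ (N - k.+1) * (lam ^+ k * y / p%:R) * v - z.
    have -> : lam ^+ (N - k.+1) * (lam ^+ k * y / p%:R) * v = y / lam.
      apply: (mulIf lam0); rewrite divfK //.
      rewrite mulr_regroup -exprD -exprSr.
      have -> : ((N - k.+1) + k).+1 = N by lia.
      by rewrite -pE mulfK.
    by rewrite yE mulrDl [lam * z]mulrC mulfK // addrK.
  apply: rpredB; last exact: inZw_Aint.
  apply: rpredM; last exact: inZw_Aint.
  by apply: rpredM => //; exact: rpredX.
have [b aE] : exists b : int, a = b * p%:Z.
  have : (a%:~R / lam) ^+ N * v' \in Aint by apply: rpredM; [exact: rpredX | exact: inZw_Aint].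
  have -> : (a%:~R / lam) ^+ N * v' = (a ^+ N)%:~R / p%:R.
    have v'0 : v' != 0 by apply: contra_eq_neq vv' => ->; rewrite mul0r eq_sym oner_neq0.
    by rewrite expr_div_n lE invfM mulrA divfK // rmorphXn.
  have Crat_aN : (a ^+ N)%:~R / p%:R \in Crat.
    by rewrite rpred_div ?rpred_int ?rpred_nat.
  move=> /(Cint_rat_Aint Crat_aN) /intrP[c cE].
  have {}cE : a ^+ N = c * p%:Z.
    apply: (@intr_inj algC); rewrite intrM /= -cE divfK //.
  have : (p %| `|a| ^ N)%N by rewrite -abszX cE abszM dvdn_mull.
  rewrite Euclid_dvdX // => /andP[/dvdnP[b bE] _].
  by have /dvdzP[b' ->] : (p %| a)%Z; [rewrite dvdzE /= bE dvdn_mull|exists b'].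
exists z => //; exists (lam ^+ k * b%:~R + y').
  apply: inZwD => //; apply: inZwM; last exact: inZw_int.
  by apply: inZwX; rewrite /lam wE -(zchar0) -[- _]mulN1r; apply: inZwD;
     [exact: inZw_zchar | apply: (@inZwZ (-1)); exact: inZw_zchar].
rewrite xE yE aE intrM exprSr -[(Posz p)%:~R]/(p%:R).
exact: mulrD_regroup.
Qed.

(** The traces in [inQw_inv] are rational algebraic integers, so [m x] lies in [Z[w]]; the [r]
    factors [p] of [m] are then divided out one by one. *)
Lemma inZw_Aint_Qw x : inQw x -> x \in Aint -> inZw x.
Proof.
move=> hQ hA.
have : inZw ((p ^ r)%:R * x).
  rewrite (inQw_inv hQ); apply: inZw_sum => j _; apply: inZwM; last exact: inZw_zchar.
  have /intrP[k ->] : T (x * chi (- j)) \is a Num.int; last exact: inZw_int.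
  apply: Cint_rat_Aint; first by apply: TrQw_rat; apply: inQwM => //; exact: inQw_zchar.
  apply: rpred_sum => u _; rewrite Aint_aut rpredM //.
  exact/inZw_Aint/inZw_zchar.
elim: r => [|k IH]; first by rewrite expn0 mul1r.
move=> h; apply: IH.
have -> : (p ^ k)%:R * x = (p ^ k.+1)%:R * x / p%:R.
  by rewrite expnS natrM mulrAC [p%:R * _]mulrC mulfK.
apply: inZw_div_p => //.
rewrite expnS natrM mulrAC [p%:R * _]mulrC mulfK // rpredM //.
by rewrite Aint_Cnat // rpred_nat.
Qed.

(** * The Galois group, norm, trace and invariant coordinates of [K] *)

Variables (K : splittingFieldType rat) (kap : {rmorphism K -> algC}).
Hypothesis galK : galois 1 {:K}.
Hypothesis kapQ : forall y, inQw (kap y).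

Local Notation n := (nf_degree K).
Local Notation G := ('Gal({:K} / 1)%g).

Lemma gal_tau_exists u :
  exists g : gal_of {:K}, (g \in G) && `[< forall y, kap (g y) = tau u (kap y) >].
Proof.
have [f0 hf0] := restrict_aut_to_normal_num_field kap (tau u).
have hA : kAut 1 {:K} (linfun f0).
  rewrite kAutfE; apply/kHomP_tmp; split=> [x /vlineP[a ->] | x y _ _].
    by rewrite !lfunE /= -[a *: 1]/(a%:A) alg_num_field fmorph_rat.
  by rewrite !lfunE /= rmorphM.
have [g gG hg] := kAut_to_gal hA.
exists g; rewrite gG; apply/asboolP => y; rewrite -hf0.
by rewrite -hg ?memvf // lfunE.
Qed.

Definition gal_tau u : gal_of {:K} := sval (cid (gal_tau_exists u)).

Lemma gal_tau_in u : gal_tau u \in G.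
Proof. by rewrite /gal_tau; case: cid => g /= /andP[]. Qed.

Lemma gal_tauE u y : kap (gal_tau u y) = tau u (kap y).
Proof. by rewrite /gal_tau; case: cid => g /= /andP[_ /asboolP]. Qed.

Lemma gal_eq_kap (g h : gal_of {:K}) : (forall y, kap (g y) = kap (h y)) -> g = h.
Proof. by move=> e; apply/eqP/gal_eqP => y _; apply: (fmorph_inj kap); apply: e. Qed.

Lemma gal_tauM u v : gal_tau (u * v)%g = (gal_tau u * gal_tau v)%g.
Proof.
apply: gal_eq_kap => y; rewrite galM ?memvf // !gal_tauE tau_mul //.
by congr (tau _ _); apply: val_inj; rewrite /= mulrC.
Qed.

Lemma card_gal : #|G| = n.
Proof. by rewrite -(galois_dim galK) dimv1 divn1. Qed.

Definition gal_nth (g : 'I_n) : gal_of {:K} := enum_val (cast_ord (esym card_gal) g).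

Definition emb (g : 'I_n) (y : K) : algC := kap (gal_nth g y).

Lemma embM g x y : emb g (x * y) = emb g x * emb g y.
Proof. by rewrite /emb !rmorphM. Qed.

Lemma embZ g a y : emb g (a *: y) = ratr a * emb g y.
Proof. by rewrite /emb linearZ /= rmorphZ_num. Qed.

Lemma emb_sum g (I : Type) (s : seq I) (P : pred I) (F : I -> K) :
  emb g (\sum_(i <- s | P i) F i) = \sum_(i <- s | P i) emb g (F i).
Proof. by rewrite /emb !rmorph_sum. Qed.

Definition tau_fiber (g : 'I_n) : nat := #|[pred u | gal_tau u == gal_nth g]|.

Lemma sum_gal_tau (V : nmodType) (F : gal_of {:K} -> V) :
  \sum_u F (gal_tau u) = \sum_g F (gal_nth g) *+ tau_fiber g.
Proof.
rewrite (partition_big gal_tau (mem G)) /=; last by move=> u _; exact: gal_tau_in.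
pose f := fun i : 'I_#|G| => enum_val i.
transitivity (\sum_(i < #|G|) F (f i) *+ #|[pred u | gal_tau u == f i]|).
  rewrite big_enum_val /=; apply: eq_bigr => i _.
  rewrite (eq_bigr (fun _ => F (f i))); last by move=> u /eqP->.
  by rewrite sumr_const.
rewrite (reindex (cast_ord (esym card_gal))) //=.
by exists (cast_ord card_gal) => i _; rewrite ?cast_ordK ?cast_ordKV.
Qed.

Lemma TrQw_kap y : T (kap y) = \sum_g emb g y *+ tau_fiber g.
Proof.
rewrite /T -(sum_gal_tau (fun g => kap (g y))); apply: eq_bigr => u _.
by rewrite gal_tauE.
Qed.

Local Notation vb := (vbasis {:K}).

Definition Vmx (b : n.-tuple K) : 'M[algC]_n := \matrix_(i, g) emb g (tnth b i).

Let gramT : 'M[algC]_n := \matrix_(i, j) T (kap (tnth vb i * tnth vb j)).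

Lemma gramTE : gramT = Vmx vb *m diag_mx (\row_g (tau_fiber g)%:R) *m (Vmx vb)^T.
Proof.
apply/matrixP => i j; rewrite mul_mx_diag !mxE TrQw_kap; apply: eq_bigr => g _.
by rewrite !mxE embM -[LHS]mulr_natr mulrAC.
Qed.

Lemma vbasis_sum (y : K) : y = \sum_i coord vb i y *: tnth vb i.
Proof.
rewrite {1}(coord_vbasis (memvf y)); apply: eq_bigr => i _.
by rewrite -tnth_nth.
Qed.

(** The matrix is rational, so a singular one has a rational null vector, that is some [y <> 0] with
    [T (y z) = 0] for all [z] in [K]. Taking [z = y^-1] contradicts [T 1 <> 0]. *)
Lemma gramT_unit : \det gramT != 0.
Proof.
have hr i j : exists q : rat, T (kap (tnth vb i * tnth vb j)) = ratr q.
  by have /CratP := TrQw_rat (kapQ (tnth vb i * tnth vb j)).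
pose Q : 'M[rat]_n := \matrix_(i, j) sval (cid (hr i j)).
have QE : gramT = map_mx ratr Q.
  by apply/matrixP => i j; rewrite !mxE; case: cid.
rewrite QE det_map_mx fmorph_eq0; apply/negP => /det0P[v v0 vQ].
pose y := \sum_i v 0 i *: tnth vb i.
have y0 : y != 0.
  apply: contraNneq v0 => yE; apply/eqP/rowP => i; rewrite mxE.
  have /freeP := basis_free (vbasisP {:K}); apply.
  by rewrite -[RHS]yE; apply: eq_bigr => k _; rewrite -tnth_nth.
have Ty j : T (kap (y * tnth vb j)) = 0.
  have := congr1 (fun M : 'rV_n => ratr (M 0 j) : algC) vQ; rewrite !mxE rmorph0 => <-.
  rewrite mulr_suml !rmorph_sum TrQw_sum; apply: eq_bigr => i _.
  rewrite -scalerAl rmorphZ_num TrQwZ [RHS]rmorphM; congr (_ * _).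
  by rewrite mxE; case: cid.
have : T (kap (y * y^-1)) = 0.
  rewrite [y^-1]vbasis_sum mulr_sumr rmorph_sum TrQw_sum big1 // => i _.
  by rewrite -scalerAr rmorphZ_num TrQwZ Ty mulr0.
rewrite divff // rmorph1 /T; under eq_bigr do rewrite rmorph1.
rewrite sumr_const => /eqP; rewrite pnatr_eq0; apply/negP.
by rewrite -lt0n; apply/card_gt0P; exists 1%g.
Qed.

Lemma Vmx_vbasis_unit : Vmx vb \in unitmx.
Proof.
rewrite unitmxE unitfE; apply: contraNneq gramT_unit => d0.
by rewrite gramTE !det_mulmx d0 !mul0r.
Qed.

(** Surjectivity of the restriction map to the Galois group of [K]: an empty fibre would put a zero
    into the diagonal factor of [gramT]. *)
Lemma tau_fiber_gt0 g : (0 < tau_fiber g)%N.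
Proof.
rewrite lt0n; apply: contraNneq gramT_unit => d0.
rewrite gramTE !det_mulmx det_diag (bigD1 g) //= !mxE d0 !mul0r mulr0 mul0r //.
Qed.

Definition Hfix : {set {unit 'Z_m}} := [set u | gal_tau u == 1%g]%SET.

Lemma Hfix_group_set : group_set Hfix.
Proof.
apply/group_setP; split=> [|u v]; rewrite !inE.
  apply/eqP; apply: gal_eq_kap => y; rewrite gal_tauE tau_one // gal_id //.
by move=> /eqP eu /eqP ev; rewrite gal_tauM eu ev mulg1.
Qed.
Canonical Hfix_group := Group Hfix_group_set.

Lemma HfixP u : reflect (forall y, tau u (kap y) = kap y) (u \in Hfix).
Proof.
rewrite inE; apply: (iffP eqP) => [eu y|h].
  by rewrite -gal_tauE eu gal_id.
by apply: gal_eq_kap => y; rewrite gal_tauE h gal_id.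
Qed.

Local Notation e := #|Hfix|.

Lemma tau_fiberE g : tau_fiber g = e.
Proof.
have /card_gt0P[u0 /eqP h0] := tau_fiber_gt0 g.
rewrite /tau_fiber -(card_rcoset _ u0) -h0; apply: eq_card => u.
rewrite mem_rcoset !inE gal_tauM; apply/eqP/eqP => [->|h].
  by rewrite -gal_tauM mulgV; apply/eqP; have := group1 Hfix_group; rewrite inE.
by rewrite -[u](mulgKV u0) !gal_tauM h mul1g.
Qed.

Lemma codegree_mul : (e * n)%N = #|{: {unit 'Z_m}}|.
Proof.
have := sum_gal_tau (fun _ => 1%N); rewrite sum1_card => ->.
under eq_bigr do rewrite tau_fiberE.
by rewrite sumr_const card_ord -mulrnA -[RHS]mulr_natr mul1r natn.
Qed.

(** The matrix of conjugates of a basis diagonalises multiplication by [x], which expresses norm and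
    trace through the embeddings. *)
Lemma mulmx_Vmx x :
  map_mx ratr (nf_mulmx x) *m Vmx vb = Vmx vb *m diag_mx (\row_g emb g x).
Proof.
apply/matrixP => i g; rewrite mul_mx_diag !mxE -embM.
rewrite [tnth vb i * x]vbasis_sum emb_sum; apply: eq_bigr => j _.
rewrite !mxE embZ; congr (ratr _ * _).
rewrite /= passmx.vecof_delta lfunE /= -tnth_nth //.
Qed.

Lemma nf_absnorm_emb x : ratr (nf_absnorm x) = \prod_g `|emb g x|.
Proof.
rewrite /nf_absnorm -normr_prod ratr_norm; congr `|_|.
rewrite -det_map_mx.
have := congr1 determinant (mulmx_Vmx x); rewrite !det_mulmx mulrC => /mulfI.
move=> ->; first by rewrite det_diag; apply: eq_bigr => g _; rewrite mxE.
by rewrite -unitfE -unitmxE Vmx_vbasis_unit.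
Qed.

Lemma nf_trace_emb x : ratr (nf_trace x) = \sum_g emb g x.
Proof.
rewrite /nf_trace -trace_map_mx.
have -> : map_mx ratr (nf_mulmx x) =
    Vmx vb *m diag_mx (\row_g emb g x) *m invmx (Vmx vb).
  by rewrite -mulmx_Vmx mulmxK ?Vmx_vbasis_unit.
rewrite mxtrace_mulC mulmxA mulVmx ?Vmx_vbasis_unit // mul1mx mxtrace_diag.
by apply: eq_bigr => g _; rewrite mxE.
Qed.

Lemma trace_disc_Vmx (b : n.-tuple K) : ratr (trace_disc b) = \det (Vmx b) ^+ 2.
Proof.
rewrite /trace_disc -det_map_mx expr2 -[X in _ * X]det_tr -det_mulmx; congr (\det _).
apply/matrixP => i j; rewrite !mxE /= nf_trace_emb; apply: eq_bigr => g _.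
by rewrite !mxE embM.
Qed.

(** A half of the Galois correspondence, by linear algebra. The conjugate [tau u x] depends only on
    [gal_tau u]; the traces of [x] against a basis of [K] are rational, and inverting the Gram
    matrix recovers rational coordinates of [x] in that basis. *)
Lemma inQw_fixed x : inQw x -> (forall h, h \in Hfix -> tau h x = x) ->
  exists y, kap y = x.
Proof.
move=> hx fx.
have tau_eq u v : gal_tau u = gal_tau v -> tau u x = tau v x.
  move=> euv; have hH : (v^-1 * u)%g \in Hfix.
    rewrite inE gal_tauM euv -gal_tauM mulVg.
    by have := group1 Hfix_group; rewrite inE.
  by rewrite -[u in LHS](mulKVg v) -tau_mul // fx.
(* The default [0] concerns only automorphisms outside the image of [gal_tau]. *)
pose F (g : gal_of {:K}) : algC :=
  if [pick u | gal_tau u == g] is Some u then tau u x else 0.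
have FE u : F (gal_tau u) = tau u x.
  rewrite /F; case: pickP => [v /eqP/tau_eq //|/(_ u)]; by rewrite eqxx.
pose rho : 'rV[algC]_n := \row_g F (gal_nth g).
pose V := Vmx vb.
pose gram : 'M[rat]_n := \matrix_(i, j) nf_trace (tnth vb i * tnth vb j).
have gramE : map_mx ratr gram = V *m V^T.
  apply/matrixP => i j; rewrite !mxE /= nf_trace_emb; apply: eq_bigr => g _.
  by rewrite !mxE embM.
have e_neq0 : e%:R != 0 :> algC.
  by rewrite pnatr_eq0 -lt0n; exact: (cardG_gt0 Hfix_group).
have sE j : exists q : rat, (rho *m V^T) 0 j = ratr q.
  apply/CratP; rewrite mxE.
  have -> : \sum_g rho 0 g * V^T g j = T (x * kap (tnth vb j)) / e%:R.
    apply: (mulIf e_neq0); rewrite divfK // mulr_suml.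
    rewrite /T; transitivity (\sum_u F (gal_tau u) * kap (gal_tau u (tnth vb j))).
      rewrite (sum_gal_tau (fun g => F g * kap (g (tnth vb j)))).
      by apply: eq_bigr => g _; rewrite !mxE tau_fiberE mulr_natr.
    by apply: eq_bigr => u _; rewrite FE gal_tauE rmorphM.
  by rewrite rpred_div ?rpred_nat // TrQw_rat //; apply: inQwM.
pose s : 'rV[rat]_n := \row_j sval (cid (sE j)).
have sE' : map_mx ratr s = rho *m V^T.
  apply/rowP => j; rewrite mxE mxE; by case: (cid (sE j)).
have Vu : V \in unitmx := Vmx_vbasis_unit.
have VTu : V^T \in unitmx by rewrite unitmx_tr.
have gu : gram \in unitmx.
  rewrite -(map_unitmx (ratr : {rmorphism rat -> algC})) gramE unitmx_mul Vu //.
pose q := s *m invmx gram.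
have rhoE : rho = map_mx ratr q *m V.
  rewrite -[rho](mulmxK VTu) -[RHS](mulmxK VTu); congr (_ *m _).
  by rewrite -sE' -mulmxA -gramE -map_mxM /q mulmxKV.
have G1 : 1%g \in G by exact: group1.
pose g0 : 'I_n := cast_ord card_gal (enum_rank_in G1 1%g).
have g0E : gal_nth g0 = 1%g.
  by rewrite /gal_nth /g0 cast_ordK enum_rankK_in.
exists (\sum_i q 0 i *: tnth vb i).
have := congr1 (fun A : 'rV_n => A 0 g0) rhoE; rewrite !mxE.
have -> : F (gal_nth g0) = x.
  have <- : gal_tau 1%g = gal_nth g0.
    by rewrite g0E; apply/eqP; have := group1 Hfix_group; rewrite inE.
  by rewrite FE tau_one.
move=> ->; rewrite rmorph_sum; apply: eq_bigr => i _.
by rewrite rmorphZ_num !mxE /emb g0E gal_id.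
Qed.

Definition Hinv (A : Type) (c : 'Z_m -> A) : Prop :=
  forall h j, h \in Hfix -> c (val h * j) = c j.

Lemma Zp_unit_mulI (h : {unit 'Z_m}) : injective (fun j : 'Z_m => val h * j).
Proof. by move=> j k; apply: mulrI; exact: (valP h). Qed.

Lemma kap_Hinv (c : 'Z_m -> rat) : Hinv c ->
  exists y, kap y = \sum_j ratr (c j) * chi j.
Proof.
move=> hc; apply: inQw_fixed; first by exists c.
move=> h hH; rewrite tau_comb [RHS](reindex_inj (@Zp_unit_mulI h)).
by apply: eq_bigr => j _; rewrite hc.
Qed.

(** The traces of [inQw_inv] are invariant because [T] does not change under [tau h], which fixes
    [kap y]. *)
Lemma kap_coords y : exists2 t : 'Z_m -> rat, Hinv t &
  (forall j, ratr (t j) = T (kap y * chi (- j))) /\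
  m%:R * kap y = \sum_j ratr (t j) * chi j.
Proof.
have hr j : exists q : rat, T (kap y * chi (- j)) = ratr q.
  by apply/CratP; apply: TrQw_rat; apply: inQwM => //; exact: inQw_zchar.
have [t ht] := choice hr.
exists t.
  move=> h j /HfixP hH; apply: (fmorph_inj (ratr : {rmorphism rat -> algC})).
  rewrite /= -!ht -[in RHS](TrQw_tau h); last first.
    by apply: inQwM => //; exact: inQw_zchar.
  by rewrite rmorphM /= hH tau_zchar mulrN.
split=> [j|]; first by rewrite ht.
by rewrite inQw_inv //; apply: eq_bigr => j _; rewrite ht.
Qed.

Lemma nf_integersP y : nf_integers K y <-> kap y \in Aint.
Proof.
split=> [[P monP /= rP]|].
  apply: (@root_monic_Aint (map_poly intr P)).
  - have -> : map_poly intr P = map_poly kap (map_poly intr P) :> {poly algC}.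
      by rewrite -map_poly_comp; apply: eq_map_poly => a /=; rewrite rmorph_int.
    by rewrite fmorph_root.
  - by rewrite monic_map.
  - by apply/polyOverP => i; rewrite coef_map /= rpred_int.
move=> /floorpP[P PE]; exists P.
  have := minCpoly_monic (kap y); rewrite PE !monicE.
  rewrite lead_coef_map_inj //; last exact: intr_inj.
  by rewrite -[X in _ == X]/(1%:~R) eqr_int.
rewrite -(fmorph_root kap) -map_poly_comp.
have -> : map_poly (kap \o intr) P = map_poly intr P.
  by apply: eq_map_poly => a /=; rewrite rmorph_int.
by rewrite -PE root_minCpoly.
Qed.

(** * Blocks of [Z/m] and the rounding of an element of [K] to an integer *)

Lemma card_nonunit : #|[pred k : 'Z_m | k \isn't a GRing.unit]| = M.
Proof. by rewrite -sum1_card big_nonunit sum1_card card_ord. Qed.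

Lemma card_units : #|{: {unit 'Z_m}}| = (M * p.-1)%N.
Proof.
have h1 : #|{: {unit 'Z_m}}| = #|[pred k : 'Z_m | k \is a GRing.unit]|.
  by rewrite -[LHS]sum1_card (big_unit _ (fun _ => 1%N)) sum1_card.
have hU : (#|{: {unit 'Z_m}}| + M)%N = m.
  rewrite h1 -card_nonunit -[RHS]m_cast -[RHS]card_ord.
  by rewrite -[RHS](cardC [pred k : 'Z_m | k \is a GRing.unit]).
have mE : m = (M * p.-1 + M)%N.
  by rewrite -mulnSr (prednK (prime_gt0 p_pr)) mulnC; exact: ppow_mul.
have key (U : nat) : (U + M)%N = m -> U = (M * p.-1)%N by rewrite mE => /addIn.
exact: key.
Qed.

Lemma nonunit_block c : c \isn't a GRing.unit -> exists j : 'Z_m, c = p%:R * j.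
Proof.
rewrite Zp_unit_dvd negbK => /dvdnP[k hk]; exists k%:R.
by rewrite -natrM mulnC -hk natr_Zp.
Qed.

Lemma block_nonunit (j : 'Z_m) : p%:R * j \isn't a GRing.unit.
Proof.
apply/negP; rewrite unitrM => /andP[+ _].
rewrite unitZpE ?ppow_gt1 // /m coprime_pexpl // prime_coprime // dvdnn //.
Qed.

(** The blocks are translates of the one over 0, and [M] of them partition a set of [p M]
    elements. *)
Lemma card_block c : c \isn't a GRing.unit -> #|[pred j : 'Z_m | p%:R * j == c]| = p.
Proof.
pose f0 := #|[pred j : 'Z_m | p%:R * j == 0]|.
have fE c' : c' \isn't a GRing.unit -> #|[pred j : 'Z_m | p%:R * j == c']| = f0.
  move=> /nonunit_block[j0 ->]; rewrite /f0 -!sum1_card (reindex_inj (addrI j0)) /=.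
  by apply: eq_bigl => j; rewrite !inE mulrDr -subr_eq0 addrC addKr.
move=> hc; rewrite fE //; apply/eqP.
have : (M * f0)%N = m.
  rewrite -card_nonunit -sum_nat_const -[RHS]m_cast -[RHS]card_ord -[RHS]sum1_card.
  rewrite [RHS](partition_big (fun j : 'Z_m => p%:R * j)
    (fun c => c \isn't a GRing.unit)) /=; last by move=> j _; exact: block_nonunit.
  by apply: eq_bigr => c' hc'; rewrite sum1_card fE.
by move: f0 {fE} => f; rewrite ppow_mul mulnC => /eqP; rewrite eqn_pmul2r.
Qed.

Lemma cyc_form_blocks (a : 'Z_m -> rat) :
  cyc_form a a = M%:R * \sum_(c : 'Z_m | c \isn't a GRing.unit)
    (p%:R * (\sum_(j | p%:R * j == c) a j ^+ 2) - (\sum_(j | p%:R * j == c) a j) ^+ 2).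
Proof.
have sub (F : 'Z_m -> rat) : (forall c, (forall j, p%:R * j != c) -> F c = 0) ->
    \sum_c F c = \sum_(c : 'Z_m | c \isn't a GRing.unit) F c.
  move=> hF; rewrite (bigID (fun c : 'Z_m => c \isn't a GRing.unit)) /= [X in _ + X]big1 ?addr0 //.
  move=> c; rewrite negbK => hc; apply: hF => j; apply: contraTneq hc => <-.
  exact: block_nonunit.
have mE : m%:R = M%:R * p%:R :> rat by rewrite -natrM mulnC -ppow_mul.
have s1 : \sum_j a j * a j =
    \sum_(c : 'Z_m | c \isn't a GRing.unit) \sum_(j | p%:R * j == c) a j ^+ 2.
  rewrite (partition_big (fun j : 'Z_m => p%:R * j)
    (fun c => c \isn't a GRing.unit)) //=; last by move=> j _; exact: block_nonunit.
rewrite /cyc_form mE s1 sub; last first.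
  by move=> c hc; rewrite big_pred0 ?mul0r // => j; apply: negbTE.
rewrite -mulrA -mulrBr; congr (_ * _); rewrite mulr_sumr -sumrB.
by apply: eq_bigr => c _; rewrite expr2.
Qed.

Lemma sum_le_exists (q : nat) (f : 'I_q -> int) (B : int) : (0 < q)%N ->
  \sum_s f s <= q%:Z * B -> exists s, f s <= B.
Proof.
move=> q0 h; apply: contrapT => /forallNP hn.
suff : q%:Z * B < \sum_s f s by rewrite ltNge h.
have -> : q%:Z * B = \sum_(s < q) B by rewrite sumr_const card_ord -mulr_natl natz.
apply: ltr_sum => [|s _]; last by rewrite ltNge; apply/negP; exact: hn.
by apply/hasP; exists (Ordinal q0); rewrite ?mem_index_enum.
Qed.

(* Average over all the shifts [s]; the shift itself is invisible, because
   [\sum_j chi j = 0]. *)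
Lemma exists_small_form (A : 'Z_m -> int) (q1 q : nat) : (0 < q1)%N -> q = (p * q1)%N ->
  exists s : 'I_q,
    cyc_form (fun j => (cres q (A j - s%:Z))%:~R / (2 * q)%:R)
             (fun j => (cres q (A j - s%:Z))%:~R / (2 * q)%:R)
    <= M%:R ^+ 2 * (p%:R ^+ 2 - 1) / 12.
Proof.
move=> q10 qE; have q0 : (0 < q)%N by rewrite qE muln_gt0 (ltnW p_gt1).
pose g (s : 'I_q) (c : 'Z_m) : int :=
  p%:Z * (\sum_(j | p%:R * j == c) cres q (A j - s%:Z) ^+ 2)
  - (\sum_(j | p%:R * j == c) cres q (A j - s%:Z)) ^+ 2.
(* The right-hand side bounds the mean over the [q] shifts, by [sum_cres_form_le] on each of the [M]
   blocks. *)
have [s hs] : exists s, 3 * \sum_(c : 'Z_m | c \isn't a GRing.unit) g s c <=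
    M%:Z * (q%:Z ^+ 2 * (p%:Z ^+ 2 - 1)).
  apply: sum_le_exists => //; rewrite -mulr_sumr exchange_big /= mulr_sumr.
  have -> : q%:Z * (M%:Z * (q%:Z ^+ 2 * (p%:Z ^+ 2 - 1))) =
      \sum_(c : 'Z_m | c \isn't a GRing.unit) (q%:Z ^+ 3 * (p%:Z ^+ 2 - 1)).
    by rewrite sumr_const card_nonunit -mulr_natl natz exprSr; ring.
  apply: ler_sum => c hc.
  exact: (sum_cres_form_le _ (card_block hc) (ltnW p_gt1) q10 qE).
exists s; rewrite cyc_form_blocks.
have q2 : (2 * q)%:R != 0 :> rat by rewrite pnatr_eq0 muln_eq0 -!lt0n q0.
have gE c : p%:R * (\sum_(j | p%:R * j == c) ((cres q (A j - s%:Z))%:~R / (2 * q)%:R) ^+ 2)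
      - (\sum_(j | p%:R * j == c) (cres q (A j - s%:Z))%:~R / (2 * q)%:R) ^+ 2 =
    (g s c)%:~R / (2 * q)%:R ^+ 2 :> rat.
  under eq_bigr do rewrite exprMn exprVn.
  rewrite -!mulr_suml exprMn exprVn mulrA -mulrBl; congr (_ / _).
  rewrite /g rmorphB rmorphM rmorphXn /= !rmorph_sum /=; congr (_ * _ - _).
  by apply: eq_bigr => j _; rewrite rmorphXn.
under eq_bigr do rewrite gE.
rewrite -mulr_suml -rmorph_sum /=.
move: hs; set S := (\sum_(c | _) _) => hs.
have hX : 3 * S%:~R <= M%:R * (q%:R ^+ 2 * (p%:R ^+ 2 - 1)) :> rat.
  by move: hs; rewrite -(ler_int rat) !rmorphM /= rmorphB /= !rmorphXn.
move: (S%:~R) hX => X hX; rewrite natrM.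
have Q0 : 0 < q%:R :> rat by rewrite ltr0n.
have M0 : 0 <= M%:R :> rat by rewrite ler0n.
have -> : M%:R * (X / (2%:R * q%:R) ^+ 2) = (M%:R / (12 * q%:R ^+ 2)) * (3 * X).
  by field; rewrite lt0r_neq0.
have -> : M%:R ^+ 2 * (p%:R ^+ 2 - 1) / 12 =
   (M%:R / (12 * q%:R ^+ 2)) * (M%:R * (q%:R ^+ 2 * (p%:R ^+ 2 - 1))) :> rat.
  by field; rewrite lt0r_neq0.
apply: ler_wpM2l hX; apply: divr_ge0 => //; apply: mulr_ge0 => //; exact: sqr_ge0.
Qed.

Lemma sum_emb_norm z :
  (\sum_g `|emb g z| ^+ 2) *+ e = T (kap z * (kap z)^*).
Proof.
rewrite TrQw_norm // -sumrMnl.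
transitivity (\sum_u `|kap (gal_tau u z)| ^+ 2).
  rewrite (sum_gal_tau (fun g => `|kap (g z)| ^+ 2)).
  by apply: eq_bigr => g _; rewrite tau_fiberE.
by apply: eq_bigr => u _; rewrite gal_tauE.
Qed.

Lemma cyc_form_ge0 a : 0 <= cyc_form a a.
Proof.
rewrite -(ler0q algC) -TrQw_form TrQw_norm; last by exists a.
by apply: sumr_ge0 => u _; rewrite exprn_ge0.
Qed.

(** The arithmetic-geometric mean inequality over the [n] embeddings of [K]; the trace from [Q(w)]
    counts each of them [e] times, and [e n = M (p - 1)]. *)
Lemma absnorm_le_form z (a : 'Z_m -> rat) :
  kap z = \sum_j ratr (a j) * chi j ->
  nf_absnorm z ^+ 2 <= (cyc_form a a / (M * p.-1)%:R) ^+ n.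
Proof.
move=> zE; rewrite -(ler_rat algC) !rmorphXn /= nf_absnorm_emb -prodrXl.
have AGM : \prod_g `|emb g z| ^+ 2 <= ((\sum_g `|emb g z| ^+ 2) / n%:R) ^+ n.
  have E0 : {in 'I_n, forall g : 'I_n, 0 <= `|emb g z| ^+ 2}.
    by move=> g _; rewrite exprn_ge0.
  have := (leif_AGM E0).1; rewrite card_ord.
  by rewrite (eq_bigl xpredT) // [X in X / _](eq_bigl xpredT).
apply: le_trans AGM _; rewrite le_eqVlt; apply/orP; left; apply/eqP; congr (_ ^+ _).
have e_gt0 : (0 < e)%N := cardG_gt0 Hfix_group.
have nz k : (0 < k)%N -> k%:R != 0 :> algC by rewrite pnatr_eq0 -lt0n.
rewrite rmorphM fmorphV /= ratr_nat -card_units -codegree_mul -TrQw_form -zE -sum_emb_norm.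
set S := \sum_g _; rewrite -(mulr_natl S) natrM invfM mulrACA divff ?nz //.
by rewrite mul1r.
Qed.

Lemma exists_close_integer y : exists2 c, nf_integers K c &
  nf_absnorm (y - c) ^+ 2 <= (M%:R * p.+1%:R / 12) ^+ n.
Proof.
have [t tH [_ ytE]] := kap_coords y.
pose d : nat := \prod_j `|denq (t j)|%N.
have d0 : (0 < d)%N by rewrite prodn_gt0 // => j; rewrite absz_gt0 denq_neq0.
pose A j : int := numq (t j * d%:R).
have AE j : (A j)%:~R = t j * d%:R.
  have : t j * d%:R \is a Num.int.
    rewrite /d (bigD1 j) //= natrM mulrA; apply: rpredM; last exact: rpred_nat.
    by rewrite -[_%:R]/((`|denq (t j)|%N : int)%:~R) absz_denq -numqE rpred_int.
  by move=> /numqK.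
have AH : Hinv A by move=> h j hH; rewrite /A tH.
(* This makes [q = m d], so that the [A j / q] are coordinates of [kap y], and a multiple of [p], as
   [exists_small_form] requires. *)
pose q1 := (M * d)%N; pose q := (p * q1)%N.
have q10 : (0 < q1)%N by rewrite muln_gt0 M_gt0.
have q0 : (0 < q)%N by rewrite muln_gt0 q10 (ltnW p_gt1).
have m0 : m%:R != 0 :> algC by rewrite pnatr_eq0 -lt0n (ltnW ppow_gt1).
have qE : q%:R = m%:R * d%:R :> rat by rewrite /q /q1 mulnA -ppow_mul natrM.
have yE : kap y = \sum_j ratr ((A j)%:~R / q%:R) * chi j.
  apply: (mulfI m0); rewrite ytE mulr_sumr; apply: eq_bigr => j _.
  rewrite mulrA -[m%:R](ratr_nat _ m) -rmorphM AE qE; congr (ratr _ * _).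
  by field; rewrite !pnatr_eq0 -!lt0n d0 (ltnW ppow_gt1).
have [s hs] := @exists_small_form A q1 q q10 erefl.
set a := (fun j : 'Z_m => _ / _) in hs.
pose cj (j : 'Z_m) : int := ((A j - s%:Z) %/ q)%Z.
have [c cE] : exists c, kap c = \sum_j ratr (cj j)%:~R * chi j.
  by apply: (kap_Hinv (c := fun j => (cj j)%:~R)) => h j hH; rewrite /cj AH.
exists c.
  apply/nf_integersP; rewrite cE; apply: inZw_Aint; exists cj.
  by apply: eq_bigr => j _; rewrite ratr_int.
have zE : kap (y - c) = \sum_j ratr (a j) * chi j.
  (* The centred errors [a j] differ from the true ones, [A j / q - cj j], by this constant, which
     [sum_zchar] makes harmless. *)
  pose k : rat := (2 * s%:R + (q%:R - 1)) / (2 * q)%:R.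
  have -> : \sum_j ratr (a j) * chi j = \sum_j ratr (a j + k) * chi j.
    under [RHS]eq_bigr do rewrite rmorphD mulrDl.
    by rewrite big_split /= -mulr_sumr sum_zchar mulr0 addr0.
  rewrite rmorphB yE cE -sumrB; apply: eq_bigr => j _; rewrite -mulrBl -rmorphB.
  congr (ratr _ * _); rewrite /a /k /cres /cj.
  have := divz_eq (A j - s%:Z) q; set D := (_ %/ _)%Z; set Z := (_ %% _)%Z; move: D Z => D Z h.
  have -> : A j = D * q%:Z + Z + s%:Z by rewrite -h subrK.
  have -> : (2 * Z - (q%:Z - 1))%:~R = 2 * Z%:~R - (q%:R - 1) :> rat.
    by rewrite !intrB intrM.
  have -> : (D * q%:Z + Z + s%:Z)%:~R = D%:~R * q%:R + Z%:~R + s%:R :> rat.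
    by rewrite !intrD intrM.
  rewrite natrM.
  by field; rewrite pnatr_eq0 -lt0n.
apply: le_trans (absnorm_le_form zE) _.
have P0 : 0 < p.-1%:R :> rat by rewrite ltr0n -ltnS prednK // ltnW.
have M0 : 0 < M%:R :> rat by rewrite ltr0n.
apply: lerXn2r; rewrite ?nnegrE.
- by rewrite divr_ge0 ?ler0n // cyc_form_ge0.
- by rewrite divr_ge0 ?mulr_ge0 ?ler0n.
rewrite natrM ler_pdivrMr ?mulr_gt0 //; apply: le_trans hs _.
rewrite le_eqVlt; apply/orP; left; apply/eqP.
have -> : p%:R = p.-1%:R + 1 :> rat by rewrite -[X in _ + X]/(1%:R) -natrD addn1 prednK // ltnW.
have -> : p.+1%:R = p.-1%:R + 2 :> rat.
  by rewrite -[X in _ + X]/(2%:R) -natrD; congr _%:R; have := p_gt1; lia.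
by field.
Qed.

(** * The subfield [Q(w ^ p)] of conductor dividing [M], and freeness of the action of [Hfix] *)

Definition inQwp (x : algC) : Prop :=
  exists q : 'Z_m -> rat, x = \sum_(j : 'Z_m | j \isn't a GRing.unit) ratr (q j) * chi j.

Lemma Zp_one_plus_unit (z : 'Z_m) : 1 + p%:R * z \is a GRing.unit.
Proof.
apply/negPn/negP => /nonunit_block[j hj].
have := block_nonunit (j - z); rewrite mulrBr -hj addrK => /negP; apply.
exact: unitr1.
Qed.

Lemma Zp_exp_p (x : 'Z_m) : odd p -> x \isn't a GRing.unit ->
  exists2 u : 'Z_m, u \is a GRing.unit & (1 + x) ^+ p - 1 = p%:R * x * u.
Proof.
move=> p_odd /nonunit_block[y xE].
have hi (i : nat) : exists c, (1 + x) ^+ i = 1 + i%:R * x + x ^+ 2 * c.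
  elim: i => [|i [c IH]]; first by exists 0; rewrite expr0 mul0r addr0 mulr0 addr0.
  exists (i%:R + c + x * c); rewrite exprS IH -natr1.
  by move: (i%:R) => I; ring.
have [c hc] := choice hi.
have sE : \sum_(i < p) (1 + x) ^+ i =
    p%:R + (p * (p./2))%:R * x + x ^+ 2 * \sum_(i < p) c i.
  under eq_bigr do rewrite hc.
  rewrite !big_split /= sumr_const card_ord -mulr_suml -mulr_sumr; congr (_ + _ * _ + _).
  rewrite -natr_sum; congr _%:R; rewrite -(big_mkord xpredT id) bin2_sum bin2.
  have -> : p.-1 = (p./2).*2 by rewrite -[in LHS](odd_double_half p) p_odd.
  by rewrite -doubleMr doubleK.
exists (1 + p%:R * ((p./2)%:R * y + y ^+ 2 * \sum_(i < p) c i)).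
  exact: Zp_one_plus_unit.
have -> : (1 + x) ^+ p - 1 = x * \sum_(i < p) (1 + x) ^+ i.
  by rewrite subrX1 addrC addKr.
rewrite sE natrM xE; move: (\sum_(i < p) c i) (p%:R : 'Z_m) ((p./2)%:R : 'Z_m) => C P H.
ring.
Qed.

(* If [Hfix] met [1 + p Z_m] nontrivially, it would contain some [1 + d] with
   [d <> 0 = p d]; translation by [d j] permutes the block of a unit [j], so the
   coordinates at units would contribute nothing and [K] would lie in [Q(w^p)]. *)
Lemma Hfix_free : odd p -> (exists y, ~ inQwp (kap y)) ->
  forall h, h \in Hfix -> val h - 1 \isn't a GRing.unit -> h = 1%g.
Proof.
move=> p_odd [y ny] h hH hx; apply: contrapT => h1; apply: ny.
(* Up to a unit [x i] is [p ^ i] times [x 0], so it vanishes at [i = r]; the last nonzero term is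
   the [d] sought. *)
pose x (i : nat) : 'Z_m := val (h ^+ (p ^ i))%g - 1.
have x0 : x 0%N != 0.
  rewrite /x expn0 expg1 subr_eq0; apply/eqP => e1; apply: h1; exact: val_inj.
have xS i : x i \isn't a GRing.unit -> exists2 u : 'Z_m, u \is a GRing.unit &
    x i.+1 = p%:R * x i * u.
  move=> hi; have [u hu uE] := Zp_exp_p p_odd hi; exists u => //.
  have e1 : 1 + x i = val (h ^+ (p ^ i))%g by rewrite /x addrC subrK.
  rewrite -uE e1 /x expnSr expgM; congr (_ - _); exact: FinRing.val_unitX.
have xn i : x i \isn't a GRing.unit.
  elim: i => [|i IH]; first by rewrite /x expn0 expg1.
  have [u hu ->] := xS i IH; rewrite -mulrA; exact: block_nonunit.
have xp i : exists2 u : 'Z_m, u \is a GRing.unit & x i = p%:R ^+ i * x 0%N * u.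
  elim: i => [|i [u hu IH]]; first by exists 1; rewrite ?unitr1 // expr0 mul1r mulr1.
  have [v hv vE] := xS i (xn i); exists (u * v); first by rewrite unitrM hu.
  by rewrite vE IH exprS; ring.
have xr : x r = 0.
  by have [u _ ->] := xp r; rewrite -natrX pchar_Zp ?ppow_gt1 // !mul0r.
have [i xi0 xi1] : exists2 i, x i != 0 & x i.+1 = 0.
  have ex : exists i, x i == 0 by exists r; rewrite xr.
  case: (ex_minnP ex) => [[|i]] /eqP xi hmin; first by rewrite xi eqxx in x0.
  by exists i => //; apply/negP => /hmin; rewrite ltnn.
pose a := (h ^+ (p ^ i))%g; pose d := x i.
have aH : a \in Hfix by exact: (@groupX _ Hfix_group).
have pd : p%:R * d = 0.
  have [u hu uE] := xS i (xn i); apply: (mulIr hu); by rewrite -uE xi1 mul0r.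
have [d' dE] := nonunit_block (xn i); rewrite -/d in dE.
have dd : d * d = 0 by rewrite {2}dE mulrCA mulrA pd mul0r.
have aE : val a = 1 + d by rewrite /d /x addrC subrK.
have acE c : val (a ^+ c)%g = 1 + d *+ c.
  elim: c => [|c IH]; first by rewrite mulr0n addr0.
  rewrite expgSr -[LHS]/(val (a ^+ c)%g * val a) IH aE mulrDr mulr1 mulrDl mul1r.
  by rewrite mulrnAl dd mul0rn addr0 -addrA -mulrSr.
have [t tH [_ ytE]] := kap_coords y.
have X0 : \sum_(j : 'Z_m | j \is a GRing.unit) ratr (t j) * chi j = 0.
  apply: (mulfI p_neq0); rewrite mulr0 mulr_natl.
  set X := \sum_(j | _) _.
  (* Averaging over the powers [1 + c d] of [a] produces, for each unit [j], the sum of all powers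
     of [chi (d j)], a [p]-th root of unity other than 1. *)
  have -> : X *+ p = \sum_(c < p)
      \sum_(j : 'Z_m | j \is a GRing.unit) ratr (t j) * chi (val (a ^+ c)%g * j).
    rewrite -[in LHS](card_ord p) -sumr_const; apply: eq_bigr => c _.
    rewrite /X (reindex_inj (@Zp_unit_mulI (a ^+ c)%g)) /=.
    apply: eq_big => [j|j _].
      by rewrite unitrM (valP (a ^+ c)%g : val (a ^+ c)%g \is a GRing.unit).
    by rewrite tH //; exact: (@groupX _ Hfix_group).
  rewrite exchange_big /= big1 // => j ju.
  have cd : chi (d * j) - 1 != 0.
    rewrite subr_eq0 zchar_eq1; apply: contra xi0 => /eqP dj0.
    by apply/eqP; apply: (mulIr ju); rewrite mul0r.
  transitivity (ratr (t j) * chi j * \sum_(c < p) chi (d * j) ^+ c).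
    rewrite mulr_sumr; apply: eq_bigr => c _.
    by rewrite acE mulrDl mul1r zcharD mulrnAl zcharMn mulrA.
  suff -> : \sum_(c < p) chi (d * j) ^+ c = 0 by rewrite mulr0.
  apply: (mulfI cd); rewrite mulr0 -subrX1 -zcharMn -mulr_natl mulrA pd mul0r.
  by rewrite zchar0 subrr.
exists (fun j => t j / m%:R).
have m0 : m%:R != 0 :> algC by rewrite pnatr_eq0 -lt0n (ltnW ppow_gt1).
apply: (mulfI m0); rewrite ytE (bigID (fun j : 'Z_m => j \is a GRing.unit)) /= X0 add0r.
rewrite mulr_sumr; apply: eq_bigr => j _.
by rewrite rmorphM fmorphV /= ratr_nat [RHS]mulrA [m%:R * _]mulrCA divff // mulr1.
Qed.

(** Rational numbers lie in [Q(w ^ p)], as multiples of [chi 0] with [0] a non-unit. *)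
Lemma degree_gt1 : (exists y, ~ inQwp (kap y)) -> (1 < n)%N.
Proof.
move=> [y ny]; rewrite ltnNge; apply/negP => n1; apply: ny.
have /vlineP[a ->] : y \in 1%VS.
  suff -> : 1%VS = {:K}%VS by rewrite memvf.
  by apply/eqP; rewrite eqEdim subvf dimv1.
exists (fun j => (j == 0)%:R * a).
rewrite (bigD1 0) ?unitr0 // big1 ?addr0 => [|j /andP[_ /negPf->]].
  have -> : (0 == 0 :> 'Z_m)%:R * a = a by rewrite eqxx mul1r.
  by rewrite zchar0 rmorphZ_num rmorph1 /= addr0.
by rewrite mul0r rmorph0 mul0r.
Qed.

(** * Existence of an integral basis *)

Lemma det_replace_row (R : comNzRingType) k (A A' : 'M[R]_k) i (q : 'I_k -> R) :
    (forall l, l != i -> row l A' = row l A) ->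
    row i A' = \sum_l q l *: row l A ->
  \det A' = q i * \det A.
Proof.
move=> h1 h2; rewrite (expand_det_row A' i).
have cE j : cofactor A' i j = \adj A j i.
  rewrite mxE /cofactor; congr (_ * \det _); apply/matrixP => a b; rewrite !mxE.
  have li : lift i a != i by rewrite eq_sym neq_lift.
  by have /rowP/(_ (lift j b)) := h1 _ li; rewrite !mxE.
have rE j : A' i j = \sum_l q l * A l j.
  have /rowP/(_ j) := h2; rewrite mxE summxE => ->.
  by apply: eq_bigr => l _; rewrite !mxE.
transitivity (\sum_l q l * \sum_j A l j * \adj A j i).
  rewrite (eq_bigr (fun j => \sum_l q l * (A l j * \adj A j i))).
    by rewrite exchange_big /=; apply: eq_bigr => l _; rewrite mulr_sumr.
  by move=> j _; rewrite cE rE mulr_suml; apply: eq_bigr => l _; rewrite mulrA.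
have aE l : \sum_j A l j * \adj A j i = \det A *+ (l == i).
  by have /matrixP/(_ l i) := mul_mx_adj A; rewrite !mxE.
rewrite (eq_bigr (fun l => q l * (\det A *+ (l == i)))); last by move=> l _; rewrite aE.
rewrite (bigD1 i) //= eqxx mulr1n [X in _ + X]big1 ?addr0 // => l li.
by rewrite (negPf li) mulr0.
Qed.

Lemma basis_Vmx_neq0 (b : n.-tuple K) : basis_of {:K} b -> \det (Vmx b) != 0.
Proof.
move=> bB; have := Vmx_vbasis_unit; rewrite unitmxE unitfE; apply: contraNneq => d0.
have -> : Vmx vb = map_mx ratr (\matrix_(i, j) coord b j (tnth vb i)) *m Vmx b.
  apply/matrixP => i g; rewrite !mxE.
  rewrite {1}(coord_basis bB (memvf (tnth vb i))) emb_sum; apply: eq_bigr => j _.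
  by rewrite embZ !mxE -tnth_nth.
by rewrite det_mulmx d0 mulr0.
Qed.

Lemma Vmx_neq0_basis (b : n.-tuple K) : \det (Vmx b) != 0 -> basis_of {:K} b.
Proof.
move=> d0; rewrite basisEfree subvf size_tuple leqnn !andbT; apply/freeP => c c0 i.
have : map_mx ratr (\row_i c i) *m Vmx b = 0.
  apply/rowP => g; rewrite !mxE -[RHS](rmorph0 (kap \o gal_nth g)) /=.
  rewrite -c0 -/(emb g _) emb_sum; apply: eq_bigr => j _.
  by rewrite embZ !mxE -tnth_nth.
have Vu : Vmx b \in unitmx by rewrite unitmxE unitfE.
move/(congr1 (mulmxr (invmx (Vmx b)))); rewrite /= mulmxK // mul0mx.
by move/rowP/(_ i); rewrite !mxE => /eqP; rewrite fmorph_eq0 => /eqP.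
Qed.

Lemma trace_disc_eq0 (b : n.-tuple K) : (trace_disc b == 0) = (\det (Vmx b) == 0).
Proof.
by rewrite -(fmorph_eq0 (ratr : {rmorphism rat -> algC})) /= trace_disc_Vmx expf_eq0.
Qed.

Lemma emb_Aint g y : nf_integers K y -> emb g y \in Aint.
Proof.
move=> /nf_integersP hy; have /card_gt0P[u /eqP hu] := tau_fiber_gt0 g.
by rewrite /emb -hu gal_tauE Aint_aut.
Qed.

Lemma trace_disc_int (b : n.-tuple K) : (forall i, nf_integers K (tnth b i)) ->
  trace_disc b \is a Num.int.
Proof.
move=> hb; rewrite -Cint_rat; apply: Cint_rat_Aint; first exact: Crat_rat.
rewrite /= trace_disc_Vmx; apply: rpredX; apply: rpred_sum => s _.
apply: rpredM; first by rewrite rpredX // rpredN Aint1.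
by apply: rpred_prod => i _; rewrite mxE emb_Aint.
Qed.

Lemma nf_integers_sub x y : nf_integers K x -> nf_integers K y -> nf_integers K (x - y).
Proof. by move=> /nf_integersP hx /nf_integersP hy; apply/nf_integersP; rewrite rmorphB rpredB. Qed.

Lemma nf_integers_mulz x (k : int) : nf_integers K x -> nf_integers K (x *~ k).
Proof.
move=> /nf_integersP hx; apply/nf_integersP; rewrite -mulrzl rmorphM rmorph_int.
by rewrite rpredM // Aint_int.
Qed.

Lemma exists_integer_multiple y : exists2 d : nat, (0 < d)%N & nf_integers K (d%:R *: y).
Proof.
have [t tH [_ ytE]] := kap_coords y.
pose d : nat := \prod_j `|denq (t j)|%N.
exists (d * m)%N.
  rewrite muln_gt0 (ltnW ppow_gt1) andbT prodn_gt0 // => j.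
  by rewrite absz_gt0 denq_neq0.
apply/nf_integersP; rewrite rmorphZ_num natrM rmorphM /= !ratr_nat -mulrA ytE mulr_sumr.
apply: rpred_sum => j _; rewrite mulrA; apply: rpredM; last exact/inZw_Aint/inZw_zchar.
suff /intrP[k kE] : d%:R * t j \is a Num.int.
  by rewrite -(ratr_nat algC d) -rmorphM kE /= ratr_int Aint_int.
rewrite /d (bigD1 j) //= natrM mulrAC; apply: rpredM; last exact: rpred_nat.
by rewrite -[_%:R]/((`|denq (t j)|%N : int)%:~R) absz_denq mulrC -numqE rpred_int.
Qed.

(* A tuple of integers of least nonzero discriminant: replacing [b_i] by an
   integer with a fractional [i]-th coordinate would decrease the discriminant. *)
Lemma integral_basis_exists : exists b : n.-tuple K, integral_basis b.
Proof.
pose P (k : nat) := exists b : n.-tuple K,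
  [/\ forall i, nf_integers K (tnth b i), trace_disc b != 0 & `|trace_disc b| = k%:R].
have natdisc (b : n.-tuple K) : (forall i, nf_integers K (tnth b i)) ->
    exists k : nat, `|trace_disc b| = k%:R.
  by move=> /trace_disc_int/intrP[z ->]; exists `|z|%N; rewrite -intr_norm -abszE.
have ex : exists k, `[< P k >].
  have exd (i : 'I_n) : exists d : nat, (0 < d)%N /\ nf_integers K (d%:R *: tnth vb i).
    by have [d h1 h2] := exists_integer_multiple (tnth vb i); exists d.
  have [d hd] := choice exd.
  pose b : n.-tuple K := [tuple (d i)%:R *: tnth vb i | i < n].
  have bi i : nf_integers K (tnth b i) by rewrite tnth_mktuple; have [] := hd i.
  have [k kE] := natdisc b bi; exists k; apply/asboolP; exists b; split=> //.
  rewrite trace_disc_eq0.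
  have -> : Vmx b = diag_mx (\row_i (d i)%:R) *m Vmx vb.
    apply/matrixP => i g; rewrite mul_diag_mx !mxE tnth_mktuple embZ ratr_nat //.
  rewrite det_mulmx det_diag mulf_neq0 //; last by rewrite -unitfE -unitmxE Vmx_vbasis_unit.
  apply/prodf_neq0 => i _; rewrite mxE pnatr_eq0 -lt0n; by have [] := hd i.
case: (ex_minnP ex) => k /asboolP[b [bi b0 bk]] kmin; exists b.
have bB : basis_of {:K} b by apply: Vmx_neq0_basis; rewrite -trace_disc_eq0.
split=> //; apply/seteqP; split=> y /=; last first.
  move=> [a ->]; apply/nf_integersP; rewrite rmorph_sum; apply: rpred_sum => i _.
  by apply/nf_integersP; apply: nf_integers_mulz; rewrite -tnth_nth.
move=> yi; pose q i := coord b i y.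
have yE : y = \sum_i q i *: tnth b i.
  by rewrite {1}(coord_basis bB (memvf y)); apply: eq_bigr => i _; rewrite -tnth_nth.
suff qi i : q i \is a Num.int.
  exists [ffun i => Num.floor (q i)]; rewrite {1}yE; apply: eq_bigr => i _.
  by rewrite ffunE -[q i in LHS](floorK (qi i)) -tnth_nth scaler_int.
apply/negPn/negP => nint.
pose f := q i - (Num.floor (q i))%:~R.
have f0 : f != 0 by apply: contraNneq nint => /eqP; rewrite subr_eq0 => /eqP->; exact: intr_int.
have f01 : 0 <= f < 1.
  have /andP[h1 h2] := floor_itv (q i); rewrite intrD mulr1z in h2.
  by rewrite /f subr_ge0 h1 ltrBlDl.
pose y' := y - tnth b i *~ Num.floor (q i).
pose b' : n.-tuple K := [tuple if l == i then y' else tnth b l | l < n].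
have b'i l : nf_integers K (tnth b' l).
  rewrite tnth_mktuple; case: eqP => // _; apply: nf_integers_sub => //.
  exact: nf_integers_mulz.
have dV : \det (Vmx b') = ratr f * \det (Vmx b).
  pose q' l : rat := if l == i then f else q l.
  have -> : ratr f = (fun l => ratr (q' l) : algC) i by rewrite /q' eqxx.
  apply: (@det_replace_row _ _ _ _ i (fun l => ratr (q' l))) => [l li|].
    by apply/rowP => g; rewrite !mxE tnth_mktuple (negPf li).
  apply/rowP => g; rewrite !mxE summxE tnth_mktuple eqxx.
  have -> : y' = \sum_l q' l *: tnth b l.
    rewrite /y' yE (bigD1 i) //= [RHS](bigD1 i) //= /q' eqxx /f scalerBl scaler_int.
    rewrite addrAC; congr (_ + _); apply: eq_bigr => l li; by rewrite (negPf li).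
  by rewrite emb_sum; apply: eq_bigr => l _; rewrite embZ !mxE.
have dE : trace_disc b' = f ^+ 2 * trace_disc b.
  apply: (fmorph_inj (ratr : {rmorphism rat -> algC})).
  by rewrite rmorphM rmorphXn /= !trace_disc_Vmx dV exprMn.
have [k' k'E] := natdisc b' b'i.
have : (k <= k')%N.
  apply: kmin; apply/asboolP; exists b'; split=> //.
  by rewrite dE mulf_neq0 // expf_neq0.
rewrite -(ler_nat rat) -k'E -bk dE normrM normrX ger0_norm; last by case/andP: f01.
have db : 0 < `|trace_disc b| by rewrite normr_gt0.
rewrite -ler_pdivrMr // divff ?gt_eqF //; apply/negP; rewrite -ltNge.
by case/andP: f01 => h1 h2; rewrite exprn_ilt1.
Qed.

(** * Orbits of [Hfix] and the lower bound for the discriminant *)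

Section FreeAction.

Hypothesis Hfree : forall h, h \in Hfix -> val h - 1 \isn't a GRing.unit -> h = 1%g.

Local Notation orb := (orbit 'U Hfix).

(** If [h] and [h'] agree on [j], then [h'^-1 h - 1] annihilates [j <> 0], so it is not a unit and
    [Hfree] applies. *)
Lemma card_orb (j : 'Z_m) : j != 0 -> #|orb j| = e.
Proof.
move=> j0; apply: card_in_imset => h h' hH h'H /= /eqP.
rewrite /FinRing.unit_act -subr_eq0 -mulrBr => /eqP j_eq.
have hK : (h'^-1 * h)%g \in Hfix by rewrite (groupM (G := Hfix_group)) ?groupV.
suff k1 : (h'^-1 * h)%g = 1%g by rewrite -(mulKVg h' h) k1 mulg1.
apply: Hfree => //; apply: contra j0 => hu; apply/eqP.
apply: (mulIr hu); rewrite mul0r; have hUn := valP h'.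
transitivity (j * (val h - val h') / val h'); last by rewrite j_eq mul0r.
apply: (mulIr hUn); rewrite divrK // -mulrA mulrBl mul1r /=.
by congr (_ * (_ - _)); rewrite mulrAC mulVr ?mul1r.
Qed.

Lemma orb0 : orb (0 : 'Z_m) = [set 0]%SET.
Proof.
apply/setP => k; rewrite inE; apply/orbitP/eqP => [[h _ <-]|->].
  by rewrite /= /FinRing.unit_act mul0r.
by exists 1%g; [exact: (group1 Hfix_group)|rewrite /= /FinRing.unit_act mul0r].
Qed.

(** The choice depends only on the set [orb j], hence is constant on orbits; the default is never
    taken, as [j] lies in its orbit. *)
Definition orep (j : 'Z_m) : 'Z_m := odflt 0 [pick k in orb j].

Lemma orep_in j : orep j \in orb j.
Proof.
rewrite /orep; case: pickP => //= /(_ j).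
by rewrite (orbit_refl 'U Hfix_group j).
Qed.

Lemma orep_eq j k : (orep j == orep k) = (j \in orb k).
Proof.
apply/eqP/idP => [ejk|jk].
  have h1 := orep_in j; rewrite (orbit_sym 'U Hfix_group) ejk in h1.
  have h2 := orep_in k.
  exact: (orbit_trans h1 h2).
by rewrite /orep (orbit_eqP (to := 'U) (G := Hfix_group) jk).
Qed.

Lemma orepK j : orep (orep j) = orep j.
Proof. by apply/eqP; rewrite orep_eq orep_in. Qed.

Lemma orep_Hinv (A : Type) (F : 'Z_m -> A) j : Hinv F -> F (orep j) = F j.
Proof.
move=> hF; have /orbitP[h hH <-] := orep_in j.
by rewrite /= /FinRing.unit_act mulrC hF.
Qed.

Lemma orep_mul k j : orep (k * orep j) = orep (k * j).
Proof.
have /orbitP[h hH <-] := orep_in j; apply/eqP; rewrite orep_eq.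
by apply/orbitP; exists h => //; rewrite /= /FinRing.unit_act mulrA.
Qed.

(** For invariant [Q], the orbits on which [Q] holds, encoded by their representatives; [ow] below
    is the size of such an orbit. *)
Definition orbType (Q : pred 'Z_m) : finType :=
  {j : 'Z_m | j \in [pred j | (orep j == j) && Q j]}.
Definition ow (j : 'Z_m) : nat := #|[pred k | orep k == j]|.

Lemma owE j : orep j == j -> ow j = if j == 0 then 1%N else e.
Proof.
move=> /eqP hj; have -> : ow j = #|orb j|.
  by apply: eq_card => k; rewrite inE -[in X in _ == X]hj orep_eq.
by have [->|/card_orb//] := eqVneq j 0; rewrite orb0 cards1.
Qed.

Lemma sum_orbType (Q : pred 'Z_m) (V : nmodType) (F : 'Z_m -> V) :
  Hinv Q -> Hinv F -> \sum_(j | Q j) F j = \sum_(o : orbType Q) F (val o) *+ ow (val o).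
Proof.
move=> hQ hF; have hp j : Q j -> (orep (orep j) == orep j) && Q (orep j).
  by move=> Qj; rewrite orepK eqxx (orep_Hinv _ hQ).
rewrite (partition_big orep (fun j => (orep j == j) && Q j)) //=.
rewrite [RHS](eq_bigr (fun o : orbType Q => \sum_(j | Q j && (orep j == val o)) F j)).
  pose f (j : 'Z_m) := \sum_(i | Q i && (orep i == j)) F i.
  rewrite -/f; transitivity (\sum_(j in [pred j | (orep j == j) && Q j]) f j) => //.
  exact: big_sub.
move=> o _; rewrite (eq_bigr (fun _ => F (val o))); last first.
  by move=> j /andP[_ /eqP <-]; rewrite (orep_Hinv _ hF).
rewrite sumr_const; congr (_ *+ _); apply: eq_card => j.
rewrite [LHS]unfold_in [RHS]unfold_in /=; apply/esym/andb_idl => /eqP ej.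
have /andP[_] : (orep (sval o) == sval o) && Q (sval o) := valP o.
by rewrite -ej (orep_Hinv _ hQ).
Qed.

Lemma card_orbType (Q : pred 'Z_m) : Hinv Q -> Q 0 ->
  #|[pred j | Q j]| = (1 + e * #|orbType Q|.-1)%N.
Proof.
move=> hQ Q0.
have h0 : (0 : 'Z_m) \in [pred j | (orep j == j) && Q j].
  by rewrite inE Q0 andbT; have := orep_in 0; rewrite orb0 inE.
have -> : #|[pred j | Q j]| = (\sum_(o : orbType Q) ow (val o))%N.
  have := sum_orbType (F := fun _ => 1%N) hQ (fun _ _ _ => erefl).
  rewrite sum1_card => ->; apply: eq_bigr => o _; exact: natn.
rewrite (bigD1 (exist _ 0 h0 : orbType Q)) //=.
rewrite owE ?eqxx //; last by case/andP: h0.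
congr (_ + _)%N; rewrite (eq_bigr (fun _ => e)).
  rewrite sum_nat_const mulnC; congr (_ * _)%N.
  by rewrite (eq_card (B := predC1 (exist _ 0 h0 : orbType Q))) // cardC1.
move=> o o0; have /andP[h1 _] : (orep (sval o) == sval o) && Q (sval o) := valP o.
rewrite owE //; case: eqP => [e0|//].
by case/eqP: o0; apply: val_inj.
Qed.

Lemma Hinv_nonunit : Hinv (fun j : 'Z_m => j \isn't a GRing.unit).
Proof.
by move=> h j _; rewrite unitrM (valP h : val h \is a GRing.unit).
Qed.

Local Notation J := (orbType xpredT).
Local Notation B := (orbType (fun j => j \isn't a GRing.unit)).

Definition block_count : nat := #|B|.

Let cardJ_eq : m = (1 + e * #|J|.-1)%N.
Proof.
rewrite -(@card_orbType xpredT) // -[LHS]m_cast -[LHS]card_ord.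
by apply: eq_card.
Qed.

Let cardB_eq : M = (1 + e * #|B|.-1)%N.
Proof.
rewrite -(card_orbType Hinv_nonunit) ?unitr0 //.
by rewrite -[LHS]card_nonunit.
Qed.

Let orb_gt0 (Q : pred 'Z_m) : Q 0 -> (0 < #|orbType Q|)%N.
Proof.
move=> Q0; apply/card_gt0P.
have h0 : (0 : 'Z_m) \in [pred j | (orep j == j) && Q j].
  by rewrite inE Q0 andbT; have := orep_in 0; rewrite orb0 inE.
by exists (exist _ 0 h0).
Qed.

Let e_gt0 : (0 < e)%N := cardG_gt0 Hfix_group.

Lemma block_countE : (e * block_count)%N = (M.-1 + e)%N.
Proof.
rewrite /block_count; have B0 : (0 < #|B|)%N by apply: orb_gt0; rewrite unitr0.
by rewrite [in RHS]cardB_eq -{1}(prednK B0) mulnS add1n /= addnC.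
Qed.

Lemma codegree_dvd : (e %| M.-1)%N.
Proof. by rewrite cardB_eq add1n dvdn_mulr. Qed.

Lemma codegree_dvd_m : exists k, m = (1 + e * k)%N.
Proof. by exists #|J|.-1; exact: cardJ_eq. Qed.

(** Removing the orbit of 0 from both counts gives [e (#|J| - #|B|) = m - M = M (p - 1) = e n]. This
    is what makes the matrix in [det_block_form_ge] square. *)
Lemma cardJ : #|J| = (n + #|B|)%N.
Proof.
have B0 : (0 < #|B|)%N by apply: orb_gt0; rewrite unitr0.
have J0 : (0 < #|J|)%N by exact: orb_gt0.
apply/eqP; rewrite -(eqn_pmul2l e_gt0) mulnDr codegree_mul card_units; apply/eqP.
have h1 := cardJ_eq; have h2 := cardB_eq; have h3 := ppow_mul.
move: h1 h2 h3 B0 J0 e_gt0 p_gt1; move: (m) (M) #|J| #|B| (e) (p).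
move=> m' M' cJ cB e' p' -> h2 h3 B0 J0 _ pp.
rewrite -(prednK B0) -(prednK J0) !mulnS.
have : (M' * p'.-1 + M' = p' * M')%N by rewrite -mulnSr (prednK (ltnW pp)) mulnC.
lia.
Qed.

(* As [m = 1 + e k], we have [kap y = m kap y - k (e kap y)]; the first term has
   the invariant integral coordinates [T (kap y * chi (- j))], and the second is
   a trace over [Hfix]. *)
Lemma kap_int_Hinv y : nf_integers K y -> exists2 beta : 'Z_m -> int,
  Hinv beta & kap y = \sum_j (beta j)%:~R * chi j.
Proof.
move=> /nf_integersP yA.
have [t tH [tE ytE]] := kap_coords y.
have [gam gamE] := inZw_Aint_Qw (kapQ y) yA.
have [k mk] := codegree_dvd_m.
have tint j : exists z : int, t j = z%:~R.
  apply/intrP; rewrite -Cint_rat /= tE; apply: Cint_rat_Aint.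
    by apply: TrQw_rat; apply: inQwM => //; exact: inQw_zchar.
  apply: rpred_sum => u _; rewrite Aint_aut rpredM //.
  exact/inZw_Aint/inZw_zchar.
have [z zE] := choice tint.
have zH : Hinv z.
  by move=> h j hH; apply: (@intr_inj rat); rewrite -!zE tH.
pose gs (j : 'Z_m) : int := \sum_(h in Hfix) gam (val h * j).
have gsH : Hinv gs.
  move=> h j hH; rewrite /gs [RHS](reindex_inj (mulIg h)) /=.
  apply: eq_big => [h'|h' _]; last by rewrite mulrA.
  by rewrite (@groupMr _ Hfix_group).
exists (fun j => z j - k%:Z * gs j).
  by move=> h j hH; rewrite zH // gsH.
have ek : e%:R * kap y = \sum_j (gs j)%:~R * chi j.
  transitivity (\sum_(h in Hfix) tau h^-1%g (kap y)).
    rewrite (eq_bigr (fun _ => kap y)).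
      by rewrite sumr_const mulr_natl.
    by move=> h hH; apply: (HfixP _ _); exact: (@groupVr _ Hfix_group).
  under [RHS]eq_bigr do rewrite /gs rmorph_sum mulr_suml.
  rewrite [RHS]exchange_big /=; apply: eq_bigr => h hH.
  rewrite {1}gamE rmorph_sum (reindex_inj (@Zp_unit_mulI h)).
  apply: eq_bigr => j _; rewrite rmorphM rmorph_int /= tau_zchar; congr (_ * chi _).
  by rewrite mulrA /= mulVr ?mul1r //; exact: (valP h).
transitivity (m%:R * kap y - k%:R * (e%:R * kap y)).
  have -> : m%:R = 1 + e%:R * k%:R :> algC.
    by have := congr1 (fun x => x%:R : algC) mk; rewrite natrD natrM.
  by rewrite mulrDl mul1r mulrA [k%:R * _]mulrC addrK.
rewrite ytE ek mulr_sumr -sumrB; apply: eq_bigr => j _.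
by rewrite zE ratr_int rmorphB rmorphM /= mulrBl mulrA.
Qed.

Lemma prod_ow (Q : pred 'Z_m) : Q 0 ->
  \prod_(o : orbType Q) (ow (val o))%:R = e%:R ^+ #|orbType Q|.-1 :> rat.
Proof.
move=> Q0.
have h0 : (0 : 'Z_m) \in [pred j | (orep j == j) && Q j].
  by rewrite inE Q0 andbT; have := orep_in 0; rewrite orb0 inE.
rewrite (bigD1 (exist _ 0 h0 : orbType Q)) //= owE ?eqxx ?mul1r; last by case/andP: h0.
rewrite (eq_bigr (fun _ => e%:R)).
  rewrite prodr_const; congr (_ ^+ _).
  by rewrite (eq_card (B := predC1 (exist _ 0 h0 : orbType Q))) // cardC1.
move=> o o0; have /andP[h1 _] : (orep (sval o) == sval o) && Q (sval o) := valP o.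
rewrite owE //; case: eqP => [e0|//].
by case/eqP: o0; apply: val_inj.
Qed.

Lemma orb_blk_proof (o : J) :
  orep (p%:R * val o) \in [pred j | (orep j == j) && (j \isn't a GRing.unit)].
Proof.
rewrite inE; apply/andP; split; first by rewrite orepK.
have hB := block_nonunit (val o); have := orep_Hinv (p%:R * val o) Hinv_nonunit.
by move=> /= h; rewrite h.
Qed.

Definition orb_blk (o : J) : B :=
  exist (fun j => j \in [pred j | (orep j == j) && (j \isn't a GRing.unit)])
    _ (orb_blk_proof o).

Lemma valB (b : B) : (orep (val b) == val b) && (val b \isn't a GRing.unit).
Proof. exact: (valP b). Qed.

Lemma orb_blk_surj (b : B) : exists o, orb_blk o = b.
Proof.
have /andP[/eqP b1 /nonunit_block[j0 b2]] := valB b.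
have hj : orep j0 \in [pred j | (orep j == j) && xpredT j] by rewrite inE orepK eqxx.
exists (exist (fun j => j \in [pred j | (orep j == j) && xpredT j]) _ hj).
by apply: val_inj; rewrite /= orep_mul -b2.
Qed.

Lemma sum_orb_blk (V : nmodType) (F : 'Z_m -> V) (b : B) : Hinv F ->
  \sum_(o | orb_blk o == b) F (val o) *+ ow (val o) =
  \sum_(c | orep c == val b) \sum_(j | p%:R * j == c) F j.
Proof.
move=> hF.
pose F' j := if orep (p%:R * j) == val b then F j else 0.
have hF' : Hinv F'.
  move=> h j hH; have oE : orep (val h * (p%:R * j)) = orep (p%:R * j).
    apply/eqP; rewrite orep_eq; apply/orbitP; exists h => //.
    by rewrite /= /FinRing.unit_act mulrC.
  by rewrite /F' (hF _ _ hH) [p%:R * (_ * _)]mulrCA oE.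
rewrite big_mkcond /= (eq_bigr (fun o : J => F' (val o) *+ ow (val o))); last first.
  move=> o _; rewrite /F' -[orb_blk o == b]/(val (orb_blk o) == val b) /=.
  by case: (orep _ == _); rewrite ?mul0rn.
rewrite -(@sum_orbType xpredT) //= -big_mkcond /=.
rewrite (partition_big (fun j : 'Z_m => p%:R * j) (fun c => orep c == val b)) //=.
apply: eq_bigr => c hc; apply: eq_bigl => j.
by apply: andb_idl => /eqP ->.
Qed.

Lemma Hinv_block_sum (V : nmodType) (F : 'Z_m -> V) : Hinv F ->
  Hinv (fun c => \sum_(j | p%:R * j == c) F j).
Proof.
move=> hF h c hH; rewrite (reindex_inj (@Zp_unit_mulI h)) /=.
apply: eq_big => [j|j _]; last by rewrite hF.
by rewrite mulrCA (inj_eq (@Zp_unit_mulI h)).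
Qed.

Lemma sum_orb_blkE (V : nmodType) (F : 'Z_m -> V) (b : B) : Hinv F ->
  \sum_(o | orb_blk o == b) F (val o) *+ ow (val o) =
  (\sum_(j | p%:R * j == val b) F j) *+ ow (val b).
Proof.
move=> hF; rewrite sum_orb_blk // (eq_bigr (fun _ => \sum_(j | p%:R * j == val b) F j)).
  by rewrite sumr_const.
by move=> c /eqP <-; rewrite (orep_Hinv _ (Hinv_block_sum hF)).
Qed.

Lemma orb_block_weight (b : B) :
  block_weight (fun o : J => ow (val o)) orb_blk b = (p * ow (val b))%N.
Proof.
have := @sum_orb_blkE _ (fun _ => 1%N) b (fun _ _ _ => erefl).
have /andP[_ hb] := valB b.
rewrite sum1_card card_block // => h.
rewrite /block_weight.
transitivity (\sum_(o | orb_blk o == b) 1%N *+ ow (val o)).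
  by apply: eq_bigr => o _; rewrite natn.
by rewrite h -mulr_natr natn.
Qed.

(** Weighting orbits by their sizes replaces the sums over [Z/m] of invariant functions;
    [M / m = 1 / p] matches the block weight [p ow(b)]. *)
Lemma orb_block_form (beta : 'I_n -> 'Z_m -> int) : (forall i, Hinv (beta i)) ->
  block_form rat (fun o : J => ow (val o)) orb_blk (fun i o => beta i (val o)) =
  m%:R^-1 *: \matrix_(i, k) cyc_form (fun j => (beta i j)%:~R) (fun j => (beta k j)%:~R).
Proof.
move=> hb; apply/matrixP => i k; rewrite !mxE /cyc_form.
pose Fi j : rat := (beta i j)%:~R; pose Fk j : rat := (beta k j)%:~R.
have hFi : Hinv Fi by move=> h j hH; rewrite /Fi hb.
have hFk : Hinv Fk by move=> h j hH; rewrite /Fk hb.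
have m0 : m%:R != 0 :> rat by rewrite pnatr_eq0 -lt0n (ltnW ppow_gt1).
have p0 : p%:R != 0 :> rat by rewrite pnatr_eq0 -lt0n (ltnW p_gt1).
rewrite mulrBr mulKf // mulrA; congr (_ - _).
  rewrite [RHS](@sum_orbType xpredT _ (fun j => Fi j * Fk j)) //.
    by apply: eq_bigr => o _; rewrite -[RHS]mulr_natl mulrA.
  by move=> h j hH; rewrite hFi // hFk.
pose si c := \sum_(j | p%:R * j == c) Fi j; pose sk c := \sum_(j | p%:R * j == c) Fk j.
have hsi : Hinv si := Hinv_block_sum hFi; have hsk : Hinv sk := Hinv_block_sum hFk.
have -> : m%:R^-1 * M%:R = p%:R^-1 :> rat.
  apply: (mulfI p0); rewrite divff // mulrCA -natrM -ppow_mul mulVf //.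
rewrite -/(si _) -/(sk _).
have -> : \sum_c si c * sk c = \sum_(c | c \isn't a GRing.unit) si c * sk c.
  rewrite (bigID (fun c : 'Z_m => c \isn't a GRing.unit)) /= [X in _ + X]big1 ?addr0 //.
  move=> c; rewrite negbK => hc; rewrite /si big_pred0 ?mul0r // => j.
  by apply: contraTF hc => /eqP <-; exact: block_nonunit.
rewrite (sum_orbType (F := fun c => si c * sk c) Hinv_nonunit); last first.
  by move=> h j hH; rewrite hsi // hsk.
rewrite mulr_sumr; apply: eq_bigr => b _; rewrite orb_block_weight.
have sE (F : 'Z_m -> rat) : Hinv F ->
    \sum_(o | orb_blk o == b) (ow (val o))%:R * F (val o) =
    (ow (val b))%:R * \sum_(j | p%:R * j == val b) F j.
  move=> hF; rewrite mulr_natl -sum_orb_blkE //.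
  by apply: eq_bigr => o _; rewrite mulr_natl.
rewrite (sE Fi hFi) (sE Fk hFk) -/(si _) -/(sk _) natrM -(mulr_natl (si _ * sk _)).
have w0 : (ow (val b))%:R != 0 :> rat.
  rewrite pnatr_eq0 -lt0n; have /andP[hb1 _] := valB b; rewrite owE //.
  by case: eqP.
by move: (si _) (sk _) => x y; field; rewrite p0 w0.
Qed.

Lemma mulr_regroup4 (R : comPzRingType) (a b c d f : R) :
  a * (b * c) * (d * f) = a * (b * f * (c * d)).
Proof. ring. Qed.

(** The Gram matrix [Cy] for the Hermitian trace form of [Q(w)] is [e] times that of [K], so its
    determinant is [e ^ n |disc|]. Insert this into [det_block_form_ge] for the invariant integral
    coordinates of [b]; by [cardJ] the powers of [e] cancel. *)
Lemma trace_disc_ge (b : n.-tuple K) :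
    (forall i, nf_integers K (tnth b i)) -> trace_disc b != 0 ->
  m%:R ^+ n <= `|trace_disc b| * p%:R ^+ block_count.
Proof.
move=> b_int nz.
have bex i : exists beta, Hinv beta /\ kap (tnth b i) = \sum_j (beta j)%:~R * chi j.
  by have [beta h1 h2] := kap_int_Hinv (b_int i); exists beta.
have [beta hbeta] := choice bex.
have betaH i : Hinv (beta i) by have [] := hbeta i.
pose Cy : 'M[rat]_n :=
  \matrix_(i, k) cyc_form (fun j => (beta i j)%:~R) (fun j => (beta k j)%:~R).
have detCy : \det Cy = e%:R ^+ n * `|trace_disc b|.
  apply: (fmorph_inj (ratr : {rmorphism rat -> algC})).
  rewrite -det_map_mx rmorphM rmorphXn /= ratr_nat ratr_norm trace_disc_Vmx.
  rewrite normrX normCK.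
  have -> : map_mx ratr Cy = e%:R *: (Vmx b *m (map_mx Num.conj (Vmx b))^T).
    apply/matrixP => i k; rewrite !mxE /= -TrQw_form.
    have kE l : kap (tnth b l) = \sum_j ratr (beta l j)%:~R * chi j.
      have [_ ->] := hbeta l; by apply: eq_bigr => j _; rewrite ratr_int.
    rewrite -!kE mulr_sumr /T.
    transitivity (\sum_u kap (gal_tau u (tnth b i)) * (kap (gal_tau u (tnth b k)))^*).
      by apply: eq_bigr => u _; rewrite rmorphM /= tau_conj // !gal_tauE.
    rewrite (sum_gal_tau (fun g => kap (g (tnth b i)) * (kap (g (tnth b k)))^*)).
    by apply: eq_bigr => g _; rewrite tau_fiberE !mxE mulr_natl.
  by rewrite detZ det_mulmx det_tr det_map_mx.
have m0 : 0 < m%:R :> rat by rewrite ltr0n (ltnW ppow_gt1).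
have e0 : 0 < e%:R :> rat by rewrite ltr0n.
have B0 : (0 < #|B|)%N by apply: orb_gt0; rewrite unitr0.
have := @det_block_form_ge rat n J B (fun o => ow (val o)) orb_blk
  (fun i o => beta i (val o)) cardJ _ orb_blk_surj.
rewrite (orb_block_form betaH) -/Cy detZ detCy => h.
have {h} : e%:R ^+ #|J|.-1 <= m%:R^-1 ^+ n * (e%:R ^+ n * `|trace_disc b|) *
     (p%:R ^+ #|B| * e%:R ^+ #|B|.-1).
  have <- : \prod_(o : J) (ow (val o))%:R = e%:R ^+ #|J|.-1 :> rat by exact: prod_ow.
  have <- : \prod_(b : B) (block_weight (fun o : J => ow (val o)) orb_blk b)%:R =
     p%:R ^+ #|B| * e%:R ^+ #|B|.-1 :> rat.
    under eq_bigr do rewrite orb_block_weight natrM.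
    by rewrite big_split /= prodr_const prod_ow // unitr0.
  apply: h => [o|].
    have /andP[h1 _] : (orep (sval o) == sval o) && true := valP o.
    by rewrite owE //; case: eqP.
  apply: mulf_neq0; first by rewrite expf_neq0 // invr_neq0 // lt0r_neq0.
  by apply: mulf_neq0; rewrite ?normr_eq0 // expf_neq0 // lt0r_neq0.
have -> : #|J|.-1 = (n + #|B|.-1)%N by rewrite cardJ -[in LHS](prednK B0) addnS.
rewrite exprD /block_count => h.
have en0 : 0 < e%:R ^+ n * e%:R ^+ #|B|.-1 :> rat by rewrite mulr_gt0 // exprn_gt0.
rewrite -(ler_pM2l en0) -(ler_pM2l (_ : 0 < m%:R^-1 ^+ n)); last by rewrite exprn_gt0 // invr_gt0.
have -> : m%:R^-1 ^+ n * (e%:R ^+ n * e%:R ^+ #|B|.-1 * m%:R ^+ n) =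
   e%:R ^+ n * e%:R ^+ #|B|.-1 :> rat.
  by rewrite exprVn mulrCA mulVf ?mulr1 // expf_neq0 // lt0r_neq0.
by rewrite -mulr_regroup4.
Qed.

End FreeAction.

End CyclotomicSums.

(** * Passage between abstract number fields and subfields of [algC] *)

Lemma algC_embedding (L : fieldExtType rat) (z : L) : <<1; z>>%VS = {:L}%VS ->
  inhabited {rmorphism L -> algC}.
Proof.
move=> genL.
have polyQ (P : {poly L}) : P \is a polyOver 1%VS ->
    exists Q : {poly rat}, P = map_poly (in_alg L) Q.
  move=> /polyOverP hP; have hc i : exists a : rat, P`_i = a%:A by apply/vlineP.
  have [c cE] := choice hc; exists (\poly_(i < size P) c i); apply/polyP => i.
  rewrite coef_map coef_poly; case: ltnP => [_|h]; first by rewrite cE.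
  by rewrite /= scale0r nth_default.
have [q0 q0E] := polyQ _ (minPolyOver 1%AS z).
have q0z : (map_poly (in_alg L) q0).[z] = 0.
  by rewrite -q0E; apply/eqP; have := root_minPoly 1%AS z.
have size_q0 : (1 < size q0)%N.
  by rewrite -(size_map_poly (in_alg L)) -q0E size_minPoly.
have [w wroot] : exists w : algC, root (map_poly ratr q0) w.
  by apply/closed_rootP; rewrite size_map_poly; case: (size q0) size_q0 => [|[]].
have repr x : exists Q : {poly rat}, x = (map_poly (in_alg L) Q).[z].
  have /Fadjoin_polyP[P hP ->] : x \in <<1%AS; z>>%VS by rewrite genL memvf.
  by have [Q ->] := polyQ _ hP; exists Q.
(* Two such polynomials differ by a multiple of the minimal polynomial of [z], which vanishes at
   [w]; hence the polynomial chosen to represent an element is immaterial. *)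
have well (Q Q' : {poly rat}) : (map_poly (in_alg L) Q).[z] = (map_poly (in_alg L) Q').[z] ->
    (map_poly ratr Q).[w] = (map_poly ratr Q').[w].
  move=> e; apply/eqP; rewrite -subr_eq0 -hornerN -hornerD -!rmorphN -rmorphD /=.
  have : root (map_poly (in_alg L) (Q - Q')) z.
    by rewrite rootE rmorphB hornerD hornerN e subrr.
  have ov : map_poly (in_alg L) (Q - Q') \is a polyOver 1%AS.
    by apply/polyOverP => i; rewrite coef_map; apply/vlineP; exists (Q - Q')`_i.
  move=> /(minPoly_dvdp ov); rewrite q0E dvdp_map => /dvdpP[R ->].
  by rewrite rmorphM hornerM (rootP wroot) mulr0.
have [g gE] := choice repr.
pose iota x : algC := (map_poly ratr (g x)).[w].
have iE x (Q : {poly rat}) : x = (map_poly (in_alg L) Q).[z] -> iota x = (map_poly ratr Q).[w].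
  by move=> xE; apply: well; rewrite -gE.
have iota_zmod : zmod_morphism iota.
  move=> x y; rewrite (iE _ (g x - g y)) /iota ?rmorphB ?hornerD ?hornerN //.
  by rewrite -!gE.
have iota_mon : monoid_morphism iota.
  split=> [|x y]; first by rewrite (iE _ 1) ?rmorph1 ?hornerC.
  by rewrite (iE _ (g x * g y)) /iota ?rmorphM ?hornerM // -!gE.
pose iM := GRing.isZmodMorphism.Build _ _ iota iota_zmod.
pose iM' := GRing.isMonoidMorphism.Build _ _ iota iota_mon.
exact: (inhabits (HB.pack iota iM iM' : {rmorphism L -> algC})).
Qed.

(** Turns a containment of images inside [algC] into an embedding of abstract fields, the form in
    which minimality of the conductor is stated. *)
Lemma sub_cyclotomic_algC (K : fieldExtType rat) (kap : {rmorphism K -> algC})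
    (k : nat) (v : algC) : k.-primitive_root v ->
    (forall y, exists P : {poly rat}, kap y = (map_poly ratr P).[v]) ->
  sub_cyclotomic K k.
Proof.
move=> prim_v kapv.
have [L [LC [[|z []] // [Dz]]] genL] := num_field_exists [:: v].
have [CtoL _ LK] := num_field_proj LC.
pose g y := CtoL (kap y).
have gE y : LC (g y) = kap y.
  have [P PE] := kapv y.
  have -> : kap y = LC (map_poly (in_alg L) P).[z].
    rewrite PE -horner_map /= Dz -map_poly_comp; congr (_.[v]).
    by apply: eq_map_poly => a /=; rewrite rmorphZ_num rmorph1 mulr1.
  by rewrite /g PE; congr (LC _); rewrite -[RHS]LK; congr CtoL; rewrite -horner_map /= Dz
    -map_poly_comp; congr (_.[v]); apply: eq_map_poly => a /=;
    rewrite rmorphZ_num rmorph1 mulr1.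
exists L.
  exists z; last by rewrite -genL adjoin_seq1.
  by rewrite -(fmorph_primitive_root LC) Dz.
have g_zmod : zmod_morphism g.
  by move=> x y; apply: (fmorph_inj LC); rewrite rmorphB !gE rmorphB.
have g_mon : monoid_morphism g.
  split=> [|x y]; first by apply: (fmorph_inj LC); rewrite gE !rmorph1.
  by apply: (fmorph_inj LC); rewrite rmorphM !gE rmorphM.
pose gM := GRing.isZmodMorphism.Build _ _ g g_zmod.
pose gM' := GRing.isMonoidMorphism.Build _ _ g g_mon.
pose gR : {rmorphism K -> L} := HB.pack g gM gM'.
pose gS := GRing.isScalable.Build _ _ _ _ gR (fmorph_numZ gR).
pose gL : {lrmorphism K -> L} := HB.pack g gM gM' gS.
by constructor; exact: (linfun_ahom gL).
Qed.

(** The default value [0] of [xget] is excluded by [p ^ r <> 0], so [nf_conductor] does have the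
    minimality property. *)
Lemma opp_dataP (K : oddPrimePowerAbelian) :
  [/\ prime (opp_prime K), odd (opp_prime K), (0 < opp_val K)%N &
      is_conductor K (opp_prime K ^ opp_val K)].
Proof.
have [p [r [p_pr p_odd r_gt0 cE]]] := opp_conductor K.
have pE : opp_prime K = p by rewrite /opp_prime cE -(prednK r_gt0) pdiv_pfactor.
have rE : opp_val K = r by rewrite /opp_val pE cE pfactorK.
rewrite rE pE; split=> //; rewrite -cE /nf_conductor; apply: xgetPex.
apply: contrapT => /forallNP hn; have := cE; rewrite /nf_conductor xgetPN // => /esym/eqP.
by rewrite expn_eq0 -leqn0 leqNgt prime_gt0.
Qed.

Lemma opp_bounds (K : oddPrimePowerAbelian) :
  let p := opp_prime K in let r := opp_val K in
  let n := nf_degree K in let M := (p ^ r.-1)%N in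
  exists e B : nat,
  [/\ [/\ (0 < e)%N, (1 < n)%N & (e %| M.-1)%N],
      (e * n = M * p.-1)%N,
      (e * B = M.-1 + e)%N,
      (p ^ r)%:R ^+ n <= nf_absdisc K * p%:R ^+ B &
      forall y : K, exists2 c, nf_integers K c &
        nf_absnorm (y - c) ^+ 2 <= (M%:R * p.+1%:R / 12) ^+ n].
Proof.
move=> p r n M; have [p_pr p_odd r_gt0 [m_gt0 [L [z prim_z genL] [f]] cmin]] := opp_dataP K.
rewrite -/p -/r in p_pr p_odd r_gt0 m_gt0 prim_z cmin.
have [iota] := algC_embedding genL.
pose w := iota z; have prim_w : (p ^ r).-primitive_root w by rewrite fmorph_primitive_root.
pose kap : {rmorphism K -> algC} := iota \o f.
have m_gt1 := ppow_gt1 p_pr r_gt0; rewrite -/p -/r in m_gt1.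
have kapQ (y : K) : inQw p r w (kap y).
  have /Fadjoin_polyP[P /polyOverP hP yE] : f y \in <<1%AS; z>>%VS by rewrite genL memvf.
  rewrite /= yE horner_coef rmorph_sum; apply: inQw_sum => i _.
  have /vlineP[a ->] := hP i; rewrite -scalerAl mul1r rmorphZ_num rmorphXn /= -/w.
  apply: inQwZ; rewrite -(zchar_nat p_pr r_gt0 prim_w); exact: inQw_zchar.
have prim_wp : M.-primitive_root (w ^+ p).
  have mE := ppow_mul p r_gt0; rewrite -/r -/M in mE.
  have -> : p = ((p ^ r) %/ M)%N by rewrite mE mulnK // expn_gt0 prime_gt0.
  by apply: (dvdn_prim_root prim_w); rewrite mE dvdn_mull.
(* Otherwise [K] would embed in the field of [M]-th roots of unity with [M < p ^ r]. *)
have nQwp : exists y, ~ inQwp p r w (kap y).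
  apply: contrapT => /forallNP hall.
  have sub : sub_cyclotomic K M.
    apply: (sub_cyclotomic_algC prim_wp (kap := kap)) => y.
    have /contrapT[q qE] := hall y; rewrite qE.
    rewrite (big_nonunit p_pr r_gt0).
    exists (\sum_(i < M) (q (p * i)%:R)%:P * 'X^i).
    rewrite rmorph_sum horner_sum; apply: eq_bigr => i _.
    rewrite rmorphM /= map_polyC map_polyXn !hornerE /=; congr (_ * _).
    by rewrite (zchar_nat p_pr r_gt0 prim_w) exprM.
  have := cmin M; rewrite expn_gt0 prime_gt0 // => /(_ isT sub); rewrite leqNgt => /negP; apply.
  by rewrite /M ltn_exp2l ?prime_gt1 // prednK.
have free := @Hfix_free p r p_pr r_gt0 w prim_w K kap kapQ p_odd nQwp.
have galK := opp_galois K.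
have [b0 bI] := integral_basis_exists p_pr r_gt0 prim_w galK kapQ.
have [b [bB bZ] dE] : exists2 b : n.-tuple K, integral_basis b & nf_absdisc K = `|trace_disc b|.
  have : [set d | exists2 b : n.-tuple K, integral_basis b & d = `|trace_disc b|] (nf_absdisc K).
    by apply: xgetPex; exists `|trace_disc b0|; exists b0.
  by [].
exists #|Hfix p_pr r_gt0 kap|, (block_count p_pr r_gt0 kap).
split.
- split; [exact: (cardG_gt0 (Hfix_group p_pr r_gt0 prim_w kapQ)) | exact: (degree_gt1 nQwp)
         | exact: (codegree_dvd prim_w kapQ free)].
- by rewrite (codegree_mul p_pr r_gt0 prim_w galK kapQ) card_units.
- exact: (block_countE prim_w kapQ free).
- rewrite dE; apply: (trace_disc_ge prim_w galK kapQ free) => [i|].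
    rewrite bZ /=; exists [ffun j => (j == i)%:Z].
    rewrite (bigD1 i) //= ffunE eqxx mulr1z -tnth_nth big1 ?addr0 // => j /negPf ji.
    by rewrite ffunE ji mulr0z.
  rewrite (trace_disc_eq0 p_pr r_gt0 prim_w galK kapQ).
  exact: (basis_Vmx_neq0 p_pr r_gt0 prim_w galK kapQ).
- exact: (exists_close_integer p_pr r_gt0 prim_w galK kapQ).
Qed.

(** The two claims amount to [eps <= 2] and [eps < 2]. As [e] divides [M - 1], it is prime to [M]
    and divides [p - 1]. If [M = 1], then [B = 1]. Otherwise [r >= 2] and
    [e B <= M - 1 + (p - 1) < M (p - 1) = e n]. *)
Lemma block_count_bound (p r n e B : nat) :
    (2 < p)%N -> (0 < r)%N -> (0 < e)%N -> (1 < n)%N -> (e %| (p ^ r.-1).-1)%N ->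
    (e * n = p ^ r.-1 * p.-1)%N -> (e * B = (p ^ r.-1).-1 + e)%N ->
  (2 * B <= r * n)%N /\ ((2 < n)%N -> (2 * B < r * n)%N).
Proof.
case: r => // r p2 _ e0 n1 /=; set M := (p ^ r)%N => edvd enE eBE.
have M0 : (0 < M)%N by rewrite expn_gt0 (ltnW (ltnW p2)).
have eM : coprime e M.
  have /(coprime_dvdl edvd) // : coprime M.-1 M.
  by rewrite -[X in coprime _ X](prednK M0) coprimenS.
have ep : (e %| p.-1)%N by rewrite -(Gauss_dvdr _ eM) -enE dvdn_mulr.
have lep : (e <= p.-1)%N by apply: dvdn_leq => //; case: (p) p2 => [|[]].
case: r @M M0 eM edvd enE eBE => [|r] M M0 eM edvd enE eBE.
  have B1 : B = 1%N.
    by apply/eqP; rewrite -(eqn_pmul2l e0) eBE /M expn0 add0n muln1.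
  by rewrite B1 mul1n.
have M3 : (2 < M)%N.
  by apply: (leq_trans p2); rewrite /M expnS leq_pmulr // expn_gt0 (ltnW (ltnW p2)).
suff : (2 * B < r.+2 * n)%N by move=> h; split=> // ; exact: ltnW.
rewrite -(ltn_pmul2l e0) mulnCA [(e * B)%N]eBE.
apply: (@leq_trans (2 * (M * p.-1))%N); last first.
  by rewrite -enE [X in (_ <= X)%N]mulnCA leq_mul2r orbC.
have P1 : (1 < p.-1)%N by case: (p) p2 => [|[|[]]].
by move: (M) (p.-1) M3 lep P1 => M' P; nia.
Qed.

(** * Real estimates for the exponent, the constant and the Euclidean minimum *)

Section RealBounds.

Variable R : realType.

(** The subtracted term is [B = (M - 1) / e + 1] with [e] eliminated through [e n = M (p - 1)], so
    that only invariants of [K] occur. *)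
Definition opp_eps (K : oddPrimePowerAbelian) : R :=
  let p := (opp_prime K)%:R in let r := (opp_val K)%:R in
  let n := (nf_degree K)%:R in let M := (opp_prime K ^ (opp_val K).-1)%:R in
  r * n / (r * n - (1 + (M - 1) * n / (M * (p - 1)))).

Definition opp_C (K : oddPrimePowerAbelian) : R :=
  Num.sqrt (((opp_prime K)%:R + 1) / (12 * (opp_prime K)%:R)).

Lemma opp_prime_gt2 (K : oddPrimePowerAbelian) : (2 < opp_prime K)%N.
Proof.
by have [p_pr p_odd _ _] := opp_dataP K; rewrite odd_prime_gt2.
Qed.

Lemma opp_epsE (K : oddPrimePowerAbelian) (e B : nat) :
    (0 < e)%N -> (e * nf_degree K = opp_prime K ^ (opp_val K).-1 * (opp_prime K).-1)%N ->
    (e * B = (opp_prime K ^ (opp_val K).-1).-1 + e)%N ->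
  opp_eps K = (opp_val K * nf_degree K)%:R / ((opp_val K * nf_degree K)%:R - B%:R).
Proof.
move=> e0 enE eBE; have p2 := opp_prime_gt2 K.
rewrite /opp_eps -natrM; congr (_ / (_ - _)).
have M0 : (0 < opp_prime K ^ (opp_val K).-1)%N by rewrite expn_gt0 (ltnW (ltnW p2)).
move: M0 enE eBE p2; move: (opp_prime K) (nf_degree K) (opp_prime K ^ (opp_val K).-1)%N => p n M.
move=> M0 enE eBE p2; have p0 : (0 < p)%N := ltnW (ltnW p2).
have h1 : e%:R * n%:R = M%:R * (p%:R - 1) :> R.
  by rewrite -natrM enE natrM; congr (_ * _); rewrite -[in RHS](prednK p0) -natr1 addrK.
have h2 : e%:R * B%:R = M%:R - 1 + e%:R :> R.
  by rewrite -natrM eBE natrD -[in RHS](prednK M0) -natr1 addrK.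
have en : e%:R != 0 :> R by rewrite pnatr_eq0 -lt0n.
have Mn : M%:R != 0 :> R by rewrite pnatr_eq0 -lt0n.
have pn : p%:R - 1 != 0 :> R.
  by rewrite subr_eq0 -[1]/(1%:R) eqr_nat gtn_eqF // ltnW.
apply: (mulfI en); rewrite h2 -h1 mulrDr mulr1 addrC; congr (_ + _).
have nn : n%:R != 0 :> R.
  have : e%:R * n%:R != 0 :> R by rewrite h1 mulf_neq0.
  by rewrite mulf_eq0 negb_or => /andP[].
by field; rewrite en nn.
Qed.

(** Here [s = r n] and [b = B]. The last clause makes [b / s] arbitrarily small for large degree,
    which is the convergence of [eps] to 1. *)
Lemma opp_eps_data (K : oddPrimePowerAbelian) : exists s b : R,
  [/\ opp_eps K = s / (s - b), 0 < b, 2 * b <= s, (2 < nf_degree K)%N -> 2 * b < s &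
   forall k : nat, ((k.+1 ^ k) + k < nf_degree K)%N -> k%:R * b <= 2 * s].
Proof.
have [e [B [[e0 n1 edvd] enE eBE _ _]]] := opp_bounds K.
have [_ _ r0 _] := opp_dataP K; have p2 := opp_prime_gt2 K.
have [h1 h2] := block_count_bound p2 r0 e0 n1 edvd enE eBE.
exists (opp_val K * nf_degree K)%:R, B%:R; split.
- exact: opp_epsE e0 enE eBE.
- by rewrite ltr0n -(ltn_pmul2l e0) muln0 eBE addn_gt0 e0 orbT.
- by rewrite -natrM ler_nat.
- by move=> /h2; rewrite -natrM ltr_nat.
move=> k; rewrite -!natrM ler_nat.
move: (opp_prime K) (opp_val K) (nf_degree K) p2 r0 n1 edvd enE eBE {h1 h2} => p r n.
set M := (p ^ r.-1)%N => p2 r0 n1 edvd enE eBE kn.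
have M0 : (0 < M)%N by rewrite expn_gt0 (ltnW (ltnW p2)).
have nM : (n <= M * p.-1)%N by rewrite -enE leq_pmull.
(* Otherwise [r <= k] and [p <= k + 1], so that [n <= M (p - 1) <= p ^ r <= (k + 1) ^ k], against
   the hypothesis on [n]. *)
have rp : (k < r * p.-1)%N.
  rewrite ltnNge; apply/negP => hk.
  have p10 : (0 < p.-1)%N by case: (p) p2 => [|[]].
  have rk : (r <= k)%N by apply: leq_trans hk; rewrite leq_pmulr.
  have pk : (p <= k.+1)%N.
    by rewrite -(prednK (ltnW (ltnW p2))) ltnS; apply: leq_trans hk; rewrite leq_pmull.
  have : (n <= k.+1 ^ k)%N.
    apply: leq_trans nM _; apply: (@leq_trans (p ^ r)%N).
      by rewrite -[X in (_ <= p ^ X)%N](prednK r0) expnSr leq_mul2l leq_pred orbT.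
    have k1 : (1 < k.+1)%N by rewrite ltnS (leq_trans r0).
    by apply: (@leq_trans (k.+1 ^ r)%N); [rewrite leq_exp2r | rewrite leq_exp2l].
  by rewrite leqNgt; move: kn; lia.
have kn' : (k < n)%N by apply: leq_trans kn; rewrite ltnS leq_addl.
rewrite -(leq_pmul2l e0) mulnCA eBE.
have -> : (e * (2 * (r * n)) = r * (M * p.-1) + r * (e * n))%N by rewrite -enE; lia.
rewrite mulnDr; apply: leq_add.
  rewrite mulnCA mulnC; apply: leq_mul; last exact: ltnW.
  exact: leq_pred.
apply: (@leq_trans (e * n)%N); last by rewrite leq_pmull.
by rewrite mulnC leq_mul2l ltnW // orbT.
Qed.

Lemma opp_C_sqr (K : oddPrimePowerAbelian) :
  opp_C K ^+ 2 = ((opp_prime K)%:R + 1) / (12 * (opp_prime K)%:R).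
Proof. by rewrite sqr_sqrtr // divr_ge0 // ?mulr_ge0 // addr_ge0. Qed.

(** Squares are compared: [C ^ 2] exceeds that of the limit by [1 / (12 p)], and a gap of [d]
    between the numbers gives a gap of at least [d ^ 2] between their squares. *)
Lemma opp_C_cvg (D : oddPrimePowerAbelian -> Prop) :
  lim_over D opp_prime opp_C (1 / (2 * Num.sqrt 3)).
Proof.
move=> d d0; exists (Num.truncn (d ^+ 2)^-1).+1 => K _ hK.
set c0 : R := 1 / (2 * Num.sqrt 3).
have c0_ge0 : 0 <= c0 by rewrite divr_ge0 // mulr_ge0 // sqrtr_ge0.
have c0E : c0 ^+ 2 = 1 / 12.
  by rewrite /c0 expr_div_n exprMn sqr_sqrtr // expr1n; congr (_ / _); ring.
have C0 : 0 <= opp_C K by exact: sqrtr_ge0.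
have P0 : 0 < (opp_prime K)%:R :> R by rewrite ltr0n (ltn_trans _ (opp_prime_gt2 K)).
have CE : opp_C K ^+ 2 = 1 / 12 + 1 / (12 * (opp_prime K)%:R).
  by rewrite opp_C_sqr; field; rewrite lt0r_neq0.
have d2 : 0 < d ^+ 2 by rewrite exprn_gt0.
have hp : 1 / (12 * (opp_prime K)%:R) < d ^+ 2.
  have : (d ^+ 2)^-1 < (opp_prime K)%:R.
    apply: lt_trans (truncnS_gt _) _; first by rewrite ltr_nat.
  rewrite ltr_pdivrMr ?mulr_gt0 // => h.
  have : d ^+ 2 * (d ^+ 2)^-1 < d ^+ 2 * (opp_prime K)%:R by rewrite ltr_pM2l.
  rewrite divff ?lt0r_neq0 //; set x := d ^+ 2 * _.
  by rewrite mulrCA -/x => hx; lra.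
have cC : c0 <= opp_C K.
  rewrite -(ler_pXn2r (n := 2)) ?nnegrE // c0E CE lerDl divr_ge0 // mulr_ge0 // ltW.
rewrite ger0_norm ?subr_ge0 // ltrBlDl ltNge; apply/negP => h.
have : (c0 + d) ^+ 2 <= opp_C K ^+ 2.
  by rewrite ler_pXn2r ?nnegrE // addr_ge0 // ltW.
have cd : 0 <= c0 * d by rewrite mulr_ge0 // ltW.
rewrite sqrrD c0E CE; move: hp cd; set u := 1 / (12 * _); set v := c0 * d; set x := d ^+ 2.
rewrite mulr2n; lra.
Qed.

(** With [s = r n], the exponent satisfies [(s - B) eps = s], so [D >= p ^ (s - B)] gives
    [sqrt D ^ eps >= p ^ (s / 2)]. The constant is such that [Y = C ^ n p ^ (s / 2)] has exactly the
    square [(M (p + 1) / 12) ^ n] of [exists_close_integer]. *)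
Lemma opp_euclidean_minimum_le (K : oddPrimePowerAbelian) :
  (euclidean_minimum R K <= (opp_C K ^+ nf_degree K *
     (Num.sqrt (ratr (nf_absdisc K)) `^ opp_eps K))%:E)%E.
Proof.
have [e [B [[e0 n1 edvd] enE eBE Dge close]]] := opp_bounds K.
have [_ _ r0 _] := opp_dataP K; have p2 := opp_prime_gt2 K.
have [h1 _] := block_count_bound p2 r0 e0 n1 edvd enE eBE.
have epsE := opp_epsE e0 enE eBE.
have B0 : (0 < B)%N by rewrite -(ltn_pmul2l e0) muln0 eBE addn_gt0 e0 orbT.
have C2 := opp_C_sqr K; have C0 : 0 <= opp_C K by exact: sqrtr_ge0.
move: (opp_C K) (opp_eps K) C2 C0 epsE => C eps C2 C0 epsE.
move: (opp_prime K) (opp_val K) p2 r0 enE eBE Dge close h1 C2 epsE edvd.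
move=> p r p2 r0 enE eBE Dge close h1 C2 epsE edvd.
set n := nf_degree K in n1 enE Dge close h1 epsE *.
have P0 : 0 < p%:R :> R by rewrite ltr0n (ltnW (ltnW p2)).
set s : R := (r * n)%:R in epsE.
have sB : 0 < s - B%:R.
  by rewrite subr_gt0 ltr_nat; apply: leq_trans h1; rewrite mul2n -addnn -[X in (X < _)%N]addn0 ltn_add2l.
have s0 : 0 < s by rewrite (lt_le_trans sB) // lerBlDr lerDl.
have eps0 : 0 <= eps by rewrite epsE divr_ge0 ?(ltW s0) ?(ltW sB).
set D : R := ratr (nf_absdisc K).
have DR : (p%:R : R) `^ (s - B%:R) <= D.
  have : (p ^ r)%:R ^+ n <= D * p%:R ^+ B.
    by move: Dge; rewrite -(ler_rat R) rmorphM !rmorphXn /= !ratr_nat.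
  rewrite natrX -exprM -!(powR_mulrn _ (ltW P0)) -/s => h.
  rewrite powRD; last by apply/implyP => _; rewrite lt0r_neq0.
  by rewrite powRN ler_pdivrMr // powR_gt0.
have D0 : 0 <= D by apply: le_trans DR; exact: powR_ge0.
have powE : Num.sqrt D `^ eps = D `^ (eps / 2).
  by rewrite -powR12_sqrt // -powRrM mulrC.
have DY : (p%:R : R) `^ (s / 2) <= Num.sqrt D `^ eps.
  rewrite powE.
  have -> : s / 2 = (s - B%:R) * (eps / 2)
    by rewrite epsE mulrA [(s - _) * _]mulrC divfK // lt0r_neq0.
  rewrite powRrM; apply: ge0_ler_powR => //; rewrite ?nnegrE ?powR_ge0 //.
  by rewrite divr_ge0.
pose Y : R := C ^+ n * p%:R `^ (s / 2).
have Y0 : 0 <= Y by rewrite mulr_ge0 ?exprn_ge0 ?powR_ge0.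
have YE : Y ^+ 2 = ((p ^ r.-1)%:R * p.+1%:R / 12) ^+ n.
  rewrite /Y exprMn -exprM mulnC exprM C2 -[X in _ * X]powR_mulrn ?powR_ge0 // -powRrM.
  rewrite divfK ?pnatr_eq0 // /s (powR_mulrn _ (ltW P0)) exprM -exprMn; congr (_ ^+ n).
  rewrite -{1}(prednK r0) exprS -natrX -addn1 natrD.
  by field; rewrite lt0r_neq0.
apply: ub_ereal_sup => _ [y _ <-].
have [c cI cN] := close y.
apply: (@le_trans _ _ (ratr (nf_absnorm (y - c)))%:E).
  by apply: ereal_inf_lbound; exists c.
rewrite lee_fin; apply: (@le_trans _ _ Y); last by rewrite /Y ler_wpM2l // exprn_ge0.
have N0 : 0 <= ratr (nf_absnorm (y - c)) :> R by rewrite ler0q normr_ge0.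
rewrite -(ler_pXn2r (n := 2)) ?nnegrE // YE.
by move: cN; rewrite -(ler_rat R) !rmorphXn /= rmorphM fmorphV rmorphM /= !ratr_nat
  rmorphXn /= ratr_nat.
Qed.

End RealBounds.

Theorem theorem3p1 (R : realType) :
  exists (eps C : oddPrimePowerAbelian -> R),
    [/\ forall K : oddPrimePowerAbelian,
          [/\ eps K <= 2, C K <= 1 / 3 &
              (euclidean_minimum R K <=
                (C K ^+ nf_degree K *
                  (Num.sqrt (ratr (nf_absdisc K)) `^ eps K))%:E)%E],
        forall K : oddPrimePowerAbelian, (2 < nf_degree K)%N -> eps K < 2,
        lim_over (fun=> True) (fun K => nf_degree K) eps 1 &
        lim_over (fun K => (2 <= opp_val K)%N) opp_prime C
          (1 / (2 * Num.sqrt 3)) /\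
        (forall e0 : nat,
          lim_over (fun K => opp_val K = 1%N /\
                            cyclotomic_codegree K (opp_prime K) e0)
            opp_prime C (1 / (2 * Num.sqrt 3)))].
Proof.
exists (opp_eps R), (opp_C R); split.
- move=> K; split; last exact: opp_euclidean_minimum_le.
    have [s [b [-> b0 sb _ _]]] := opp_eps_data R K.
    by rewrite ler_pdivrMr; lra.
  rewrite -(ler_pXn2r (n := 2)) ?nnegrE ?sqrtr_ge0 ?divr_ge0 // opp_C_sqr.
  have p3 : 3 <= (opp_prime K)%:R :> R.
    by rewrite -[3]/(3%:R) ler_nat opp_prime_gt2.
  rewrite expr_div_n expr1n ler_pdivrMr; last by lra.
  by move: p3; set p := (opp_prime K)%:R => p3; lra.
- move=> K n2; have [s [b [-> b0 _ /(_ n2) sb _]]] := opp_eps_data R K.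
  by rewrite ltr_pdivrMr; lra.
(* Since [eps - 1 = b / (s - b)], the goal is [b < d (s - b)]. From [k d > 4] and [k b <= 2 s]
   follows [b < d s / 2], and [2 b <= s] gives [d b <= d s / 2]. *)
- move=> d d0; pose k := (Num.truncn (4 / d)).+1.
  exists (k.+1 ^ k + k)%N => K _ /= hn.
  have [s [b [-> b0 sb _ /(_ k hn) kb]]] := opp_eps_data R K.
  have k4 : 4 < k%:R * d.
    by rewrite -ltr_pdivrMr // /k; apply: truncnS_gt.
  have sb0 : 0 < s - b by lra.
  have -> : s / (s - b) - 1 = b / (s - b) by field; rewrite lt0r_neq0.
  rewrite ger0_norm ?divr_ge0 ?ltW // ltr_pdivrMr //.
  have h1 : k%:R * b * d <= 2 * s * d by rewrite ler_pM2r.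
  have h2 : 4 * b < k%:R * d * b by rewrite ltr_pM2r.
  have h3 : 2 * b * d <= s * d by rewrite ler_pM2r.
  rewrite mulrBr; move: h1 h2 h3; rewrite mulrAC.
  have -> : 2 * s * d = 2 * (d * s) by ring.
  have -> : 2 * b * d = 2 * (d * b) by ring.
  rewrite [s * d]mulrC; move: (d * s) (d * b) (k%:R * d * b) => x y z; lra.
- by split=> [|e0]; exact: opp_C_cvg.
Qed.
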